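(* Let $\{\lambda^{(j)}_k\}_{k=1}^\infty$, $j=1,\dots,p$, be non-decreasing sequences of positive real numbers, with counting functions $N_j$, and let $N$ be the counting function of the $p$-fold products. Assume there are non-negative numbers $\tau<\alpha$ and (distinct) indices $j_1,\dots,j_\nu\in\{1,\dots,p\}$, where $1\le\nu\le p$, such that $$N_{j_q}(\lambda)=A_{j_q}\lambda^{\alpha}+O(\lambda^{\tau}),\quad\lambda\to\infty,\quad q=1,\dots,\nu,$$ with $A_{j_q}\ne0$, and $$N_j(\lambda)=O(\lambda^\tau),\quad \lambda\to\infty,\quad j\notin\{j_1,\dots,j_\nu\}.$$ Then there exist $\eta<\alpha$ and constants $C_0,\dots,C_{\nu-2}$ such that, as $\lambda\to\infty$, $$N(\lambda)=\sum_{q=1}^{\nu}\frac{B_q}{(q-1)!}\left(\frac{d}{dz}\right)^{q-1}\left.\left(\frac{\lambda^z}{z}\right)\right|_{z=\alpha}+O(\lambda^{\eta})=\lambda^{\alpha}\left(A\frac{(\alpha\log\lambda)^{\nu-1}}{(\nu-1)!}+\sum_{q=0}^{\nu-2}C_q\log^q\lambda\right)+O(\lambda^\eta),$$ where $$A=\left(\prod_{q=1}^{\nu}A_{j_q}\right)\cdot\left(\prod_{j\notin\{j_1,\dots,j_\nu\}}\left(\sum_{k=1}^\infty\frac{1}{(\lambda^{(j)}_k)^{\alpha}}\right)\right)$$ and $$B_q=\frac{1}{(\nu-q)!}\left(\frac{d}{dz}\right)^{\nu-q}\left.\left((z-\alpha)^{\nu}\prod_{j=1}^{p}\sum_{k=1}^\infty\frac{1}{(\lambda_k^{(j)})^{z}}\right)\right|_{z=\alpha},\quad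 q=1,\dots,\nu.$$
   Context: $N_j(\lambda)=\#\{k\in\mathbb{N}:\lambda^{(j)}_k\le\lambda\}$ for $j=1,\dots,p$, and $N(\lambda)=\#\{(k_1,\dots,k_p)\in\mathbb{N}^p:\lambda^{(1)}_{k_1}\lambda^{(2)}_{k_2}\cdots\lambda^{(p)}_{k_p}\le\lambda\}$, where here $\mathbb{N}=\{1,2,\dots\}$ indexes the sequences. Empty products equal $1$ and empty sums equal $0$. In the formula for $B_q$, the function $(z-\alpha)^\nu\prod_j\sum_k(\lambda_k^{(j)})^{-z}$, given by the series for $\operatorname{Re}z>\alpha$, is understood via its analytic continuation to a neighbourhood of $z=\alpha$. *)

(* Defs.v *)
From HB Require Import structures.
From mathcomp Require Import all_boot all_order all_algebra.
From mathcomp Require Import all_classical all_reals all_analysis.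
From mathcomp.real_closed Require Import complex.

Set Implicit Arguments.
Unset Strict Implicit.
Unset Printing Implicit Defensive.

Import Order.TTheory GRing.Theory Num.Theory.
Import numFieldNormedType.Exports.

Local Open Scope classical_set_scope.
Local Open Scope ring_scope.

(* Lets the Landau notations be used at +oo. *)
Canonical pinfty_filter_on (R : numFieldType) : filter_on R :=
  FilterType (pinfty_nbhs R) _.

(* The complex numbers R[i].  Going through an explicit numFieldType gives them
   the topology and the normed-module structure that MathComp-Analysis attaches
   to every numFieldType, hence limits, 'O and derive1n. *)
Definition Cfield (R : realType) : numFieldType := R[i]%C.

Definition toC (R : realType) (x : R) : Cfield R := (x%:C)%C.

(* x ^ z = exp (z ln x) for a real base x > 0 and a complex exponent z. *)
Definition cpow (R : realType) (x : R) (z : Cfield R) : Cfield R :=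
  let a := complex.Re z * ln x in
  let b := complex.Im z * ln x in
  ((expR a * cos b) +i* (expR a * sin b))%C.

(* #{t : f t <= x}, equal to +oo when that set is infinite. *)
Definition counting_fun (R : realType) (T : choiceType) (f : T -> R) (x : R) :
  \bar R := counting [set t | f t <= x].

(* Sequences are indexed from 0: u k is the (k+1)-st term. *)
Definition dirichlet_sum (R : realType) (u : R ^nat) (z : Cfield R) : Cfield R :=
  limn (series (fun k => 1 / cpow (u k) z)).

Definition prod_fun (R : realType) (p : nat) (lam : 'I_p -> R ^nat)
  (k : {ffun 'I_p -> nat}) : R := \prod_(j < p) lam j (k j).

Definition analytic_at (K : numFieldType) (F : K -> K) (c : K) : Prop :=
  exists a : nat -> K,
    \forall z \near c, series (fun n => a n * (z - c) ^+ n) @ \oo --> F z.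

(* F continues analytically to a neighbourhood of alpha the function G, where
   G is considered on the half-plane Re z > alpha. *)
Definition continuation_at (R : realType) (alpha : R)
    (G F : Cfield R -> Cfield R) : Prop :=
  analytic_at F (toC alpha) /\
  \forall z \near toC alpha, alpha < complex.Re z -> F z = G z.

(* The q-th coefficient of the principal part at alpha of a function with a
   pole of order at most nu there, F z being (z - alpha) ^ nu times it. *)
Definition polar_coef (R : realType) (alpha : R) (nu : nat)
    (F : Cfield R -> Cfield R) (q : nat) : Cfield R :=
  1 / (nu - q)`!%:R * derive1n (nu - q) F (toC alpha).

(* Main.v *)
Require Import Defs.
From HB Require Import structures.
From mathcomp Require Import all_boot all_order all_algebra.
From mathcomp Require Import finmap.
From mathcomp Require Import all_classical all_reals all_analysis.
From mathcomp.real_closed Require Import complex.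
From mathcomp Require Import ring lra zify.

Set Implicit Arguments.
Unset Strict Implicit.
Unset Printing Implicit Defensive.

Import Order.TTheory GRing.Theory Num.Theory.
Import numFieldNormedType.Exports.

Local Open Scope classical_set_scope.
Local Open Scope ring_scope.

(** Taking logarithms turns products into sums: with [u = ln x], the counting
    functions become [M(u) = #{h <= u}] for families [h] of real numbers, and the
    hypotheses say that [exp (- alpha u) M(u)] is a constant up to an exponentially
    small error.  The proof follows three steps.

    Call a function of [u >= 0] almost polynomial when it is a polynomial up to
    [O(exp (- d u))] with [d > 0].  If the normalised counting functions of two
    families are almost polynomial, so is that of their sums: by the hyperbola method
    ([hyperbola], [almost_poly_hadd]) it is expressed by partial sums up to [u / 2],
    and those are almost polynomial by Abel summation ([abelI_increment],
    [twisted_almost_poly]).  Hence there is a polynomial [P] with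
    [N(x) = x^alpha P(ln x) + O(x^eta)] for some [eta < alpha] ([hsum_almost_poly]).  Integrals
    are replaced by an induction on the jumps of the counting function, with the mean
    value theorem between two jumps.

    Each Dirichlet series is [A alpha / (z - alpha)] plus a power series in
    [z - alpha], where [A = 0] for the sequences without main term
    ([single_continuation]).  The coefficients of the power series are obtained by
    the same Abel summation, which bounds them geometrically.  Multiplying the
    factors gives the analytic continuation of [G], and its value
    [alpha^nu A] at [alpha].

    Finally, for real [t > 0], the Dirichlet series of the products at [alpha + t] is
    [(alpha + t)] times the Laplace transform of [P] at [t], up to a bounded error
    ([is_dsum_polar]), and it is also the product of the individual series.
    Comparing expansions as [t] tends to 0 expresses the first [nu] Taylor coefficients
    of any continuation of [G] by the coefficients of [P] ([coef_identification]).
    The sum over [q] in the statement is the residue at [alpha] of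
    [F(z) / (z - alpha)^nu * x^z / z], and therefore equals [x^alpha P(ln x)]
    ([residue_sum]); the leading coefficient of [P] is read off from the value of the
    continuation at [alpha]. *)

(** * Sums over locally finite families and Abel summation *)

(** A family [h] of real numbers is locally finite when only finitely many of
    its members lie below any given bound.  Throughout, [h] is the family of
    logarithms of a family of positive reals, so that products of such reals
    become sums. *)
Definition loc_fin {R : realType} {T : choiceType} (h : T -> R) :=
  forall u, finite_set [set t | h t <= u].

(** The sum of [c t] over the finitely many indices [t] with [h t <= u]. *)
Definition psum {R : realType} {T : choiceType} {V : nmodType} (h : T -> R)
    (c : T -> V) (u : R) : V :=
  \sum_(t <- fset_set [set t | h t <= u]) c t.

Section PartialSums.
Context {R : realType} {T : choiceType}.
Implicit Types (h : T -> R) (u v : R).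

(** The sum may be computed over any duplicate-free list that contains the
    relevant indices; no separate finiteness hypothesis is needed. *)
Lemma psum_seq {V : nmodType} h (c : T -> V) u (L : seq T) : uniq L ->
  (forall t, h t <= u -> t \in L) ->
  psum h c u = \sum_(t <- L | h t <= u) c t.
Proof.
move=> uL hL; have fin : finite_set [set t | h t <= u].
  apply: (@sub_finite_set _ _ [set` L]); last exact: finite_seq.
  by move=> t /= /hL.
rewrite /psum -[RHS]big_filter; apply: perm_big; apply: uniq_perm.
- exact: fset_uniq.
- exact/filter_uniq.
move=> t; rewrite mem_filter in_fset_set //.
apply/idP/idP => [|/andP[htu _]]; last by rewrite inE.
by rewrite inE /= => htu; rewrite htu (hL _ htu).
Qed.

Lemma psum_widen {V : nmodType} h (c : T -> V) u X : loc_fin h -> u <= X ->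
  psum h c u = \sum_(t <- fset_set [set t | h t <= X] | h t <= u) c t.
Proof.
move=> hfin uX; apply: psum_seq => [|t htu]; first exact: fset_uniq.
rewrite in_fset_set // inE /=.
exact: le_trans htu uX.
Qed.

Lemma ler_psum h (c c' : T -> R) u : loc_fin h ->
  (forall t, h t <= u -> c t <= c' t) -> psum h c u <= psum h c' u.
Proof.
move=> hfin cc'; rewrite !(psum_widen _ hfin (lexx u)).
by apply: ler_sum => t /cc'.
Qed.

Lemma psum_ge0 h (c : T -> R) u : (forall t, 0 <= c t) -> 0 <= psum h c u.
Proof. by move=> c0; apply: sumr_ge0. Qed.

Lemma psum_mono h (c : T -> R) u v : loc_fin h -> (forall t, 0 <= c t) ->
  u <= v -> psum h c u <= psum h c v.
Proof.
move=> hfin c0 uv; rewrite (psum_widen _ hfin uv) /psum big_mkcond /=.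
by apply: ler_sum => t _; case: ifP.
Qed.

Lemma ler_norm_psum h (c : T -> R) u : `|psum h c u| <= psum h (fun t => `|c t|) u.
Proof. exact: ler_norm_sum. Qed.

(** The counting function of [h], with real values. *)
Definition cnt h u : R := psum h (fun=> 1) u.

Lemma cntE h u : cnt h u = #|` fset_set [set t | h t <= u]|%:R.
Proof. by rewrite /cnt /psum big_const_seq count_predT iter_addr_0. Qed.

Lemma norm_increment_le (La La' F F' : R -> R) (a b : R) : a <= b ->
  (forall x : R, is_derive x 1 La (La' x)) -> (forall x : R, is_derive x 1 F (F' x)) ->
  (forall v, a < v < b -> `|F' v| <= La' v) ->
  `|F b - F a| <= La b - La a.
Proof.
move=> ab dLa dF bnd.
(* s is a sign: both bounds on the increment of F are treated at once *)
have key (s : R) : s ^+ 2 = 1 -> s * (F b - F a) <= La b - La a.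
  move=> s2; have s1 : `|s| = 1.
    by apply/eqP; rewrite -sqrp_eq1 ?real_normK ?num_real ?s2.
  have dg (x : R) : is_derive x 1 (fun y => s * F y - La y) (s * F' x - La' x).
    apply: is_deriveB.
  move: ab; rewrite le_eqVlt => /predU1P[->|ab]; first by rewrite !subrr mulr0.
  have [|c' cab' E'] := @MVT R (fun y => s * F y - La y)
    (fun x => s * F' x - La' x) a b ab (fun x _ => dg x).
    by apply: derivable_within_continuous => x _.
  have {}/bnd : a < c' < b by move: cab'; rewrite in_itv.
  have := ler_norm (s * F' c'); rewrite normrM s1 mul1r => h1 h2.
  have h3 : (s * F' c' - La' c') * (b - a) <= 0.
    apply: mulr_le0_ge0; last by rewrite subr_ge0 ltW.
    by rewrite subr_le0 (le_trans h1).
  move: E' h3 => <-; lra.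
rewrite ler_norml; apply/andP; split.
  by have := key (-1); rewrite sqrrN expr1n => /(_ erefl); lra.
by have := key 1; rewrite expr1n => /(_ erefl); lra.
Qed.

(** Up to an additive constant this is the integral up to [v] of
    [cnt h * phi' - Th'].  Since [phi v - phi (h t)] vanishes when [h t = v], it is
    a continuous function of [v] although [cnt h] is a step function, which is
    what makes Abel summation available without any theory of integration. *)
Definition abelI h (phi Th : R -> R) (v : R) : R :=
  psum h (fun t => phi v - phi (h t)) v - Th v.

Lemma abelIE h phi Th v :
  abelI h phi Th v = cnt h v * phi v - psum h (phi \o h) v - Th v.
Proof.
rewrite /abelI /cnt /psum; congr (_ - _).
by rewrite sumrB; congr (_ - _); rewrite big_distrl /=; under [RHS]eq_bigr do rewrite mul1r.
Qed.

(** On an interval without jumps [cnt h] is constant, and the mean value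
    theorem applies. *)
Lemma abelI_increment_nojump h (phi Th La phi' Th' La' : R -> R) a b :
  loc_fin h -> a <= b -> 
  (forall x : R, is_derive x 1 phi (phi' x)) ->
  (forall x : R, is_derive x 1 Th (Th' x)) ->
  (forall x : R, is_derive x 1 La (La' x)) ->
  (forall v, a < v < b -> `|cnt h v * phi' v - Th' v| <= La' v) ->
  (forall t, ~~ (a < h t < b)) ->
  `|abelI h phi Th b - abelI h phi Th a| <= La b - La a.
Proof.
move=> hfin ab dphi dTh dLa bnd nojump.
pose F v := cnt h a * phi v - psum h (phi \o h) a - Th v.
have dF (x : R) : is_derive x 1 F (cnt h a * phi' x - Th' x).
  rewrite /F -[_ * phi' x]subr0.
  apply: is_deriveB.
have cst v : a <= v -> v < b -> cnt h v = cnt h a.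
  move=> av vb; rewrite /cnt (psum_widen _ hfin av) /psum [LHS]big_mkcond.
  rewrite [RHS]big_mkcond !big_seq.
  apply: eq_bigr => t; rewrite in_fset_set // inE /= => htv.
  case: ifP => // /negbT; rewrite -ltNge => aht.
  by have := nojump t; rewrite aht (le_lt_trans htv vb).
have Fb : abelI h phi Th b = F b.
  rewrite /abelI /F; congr (_ - _).
  transitivity (\sum_(t <- fset_set [set t | h t <= b] | h t <= a) (phi b - phi (h t))).
    rewrite /psum [RHS]big_mkcond !big_seq /=; apply: eq_bigr => t.
    rewrite in_fset_set // inE /= => htb; case: ifP => // /negbT.
    rewrite -ltNge => aht; have := nojump t; rewrite aht /= -leNgt => bht.
    by rewrite (@le_anti _ _ b (h t)) ?subrr// bht htb.
  rewrite -(psum_widen _ hfin ab) /psum sumrB; congr (_ - _).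
  by rewrite /cnt /psum big_distrl /=; under [RHS]eq_bigr do rewrite mul1r.
have Fa : abelI h phi Th a = F a by rewrite abelIE.
rewrite Fb Fa; apply: norm_increment_le ab dLa dF _ => v avb.
by rewrite -(cst v) ?bnd//; case/andP: avb => // /ltW.
Qed.

(** If the integrand is bounded by [La'], then the increments of the integral are
    bounded by those of [La].  The proof is by induction on the number of jumps
    inside the interval, which is split at one of them. *)
Lemma abelI_increment h (phi Th La phi' Th' La' : R -> R) a b :
  loc_fin h -> a <= b ->
  (forall x : R, is_derive x 1 phi (phi' x)) ->
  (forall x : R, is_derive x 1 Th (Th' x)) ->
  (forall x : R, is_derive x 1 La (La' x)) ->
  (forall v, a < v < b -> `|cnt h v * phi' v - Th' v| <= La' v) ->
  `|abelI h phi Th b - abelI h phi Th a| <= La b - La a.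
Proof.
move=> hfin ab dphi dTh dLa.
pose J a b := [set t | a < h t < b].
have Jfin c d : finite_set (J c d).
  by apply: sub_finite_set (hfin d) => t /= /andP[_ /ltW].
have [n] := ubnP #|` fset_set (J a b)|.
elim: n => // n IHn in a b ab *; rewrite ltnS => cardJ bnd.
have [[t0 /= /andP[at0 t0b]]|nojump] := pselect (exists t, J a b t); last first.
  apply: abelI_increment_nojump dphi dTh dLa bnd _ => // t.
  by apply/negP => tJ; apply: nojump; exists t.
set c := h t0 in at0 t0b.
have inJ x y t : (t \in fset_set (J x y)) = (x < h t < y).
  by rewrite in_fset_set //; apply/idP/idP => [/set_mem//|?]; exact/mem_set.
have sub1 : (#|` fset_set (J a c)| < n)%N.
  apply: leq_trans cardJ; apply: fproper_ltn_card.
  rewrite fproperE; apply/andP; split.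
    by apply/fsubsetP => t; rewrite !inJ => /andP[-> /lt_trans]; exact.
  by apply/fsubsetPn; exists t0; rewrite inJ ?at0 ?t0b ?ltxx ?andbF.
have sub2 : (#|` fset_set (J c b)| < n)%N.
  apply: leq_trans cardJ; apply: fproper_ltn_card.
  rewrite fproperE; apply/andP; split.
    by apply/fsubsetP => t; rewrite !inJ => /andP[/(lt_trans at0) -> ->].
  by apply/fsubsetPn; exists t0; rewrite inJ ?at0 ?t0b ?ltxx.
have h1 : `|abelI h phi Th c - abelI h phi Th a| <= La c - La a.
  apply: (IHn _ _ (ltW at0) sub1) => v /andP[av vc].
  by apply: bnd; rewrite av (lt_trans vc).
have h2 : `|abelI h phi Th b - abelI h phi Th c| <= La b - La c.
  apply: (IHn _ _ (ltW t0b) sub2) => v /andP[cv vb].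
  by apply: bnd; rewrite vb (lt_trans at0).
rewrite (_ : _ - _ = (abelI h phi Th b - abelI h phi Th c) +
   (abelI h phi Th c - abelI h phi Th a)); last by ring.
by apply: le_trans (ler_normD _ _) _; lra.
Qed.

End PartialSums.

(** * Functions that are polynomial up to an exponentially small error *)

Section AlmostPoly.
Context {R : realType}.
Implicit Types (g : R -> R) (P Q : {poly R}) (d e u : R).

(** [g u = P(u) + O(exp (- d u))] for [u >= 0]. *)
Definition poly_upto g P d := exists2 C, 0 <= C &
  forall u, 0 <= u -> `|g u - P.[u]| <= C * expR (- d * u).

(** The same for some polynomial and some positive rate.  These functions form
    a ring stable under [u |-> u / 2], so the polynomials need not be computed. *)
Definition almost_poly g := exists P d, 0 < d /\ poly_upto g P d.

Lemma exp_ge_pow_fact (x : R) n : 0 <= x -> x ^+ n / n`!%:R <= expR x.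
Proof.
case: n => [|n] x0; first by rewrite expr0 fact0 divr1 -expR0 ler_expR.
by apply: le_trans (expR_ge1Dxn n x0); rewrite lerDr.
Qed.

Lemma poly_le_exp P e : 0 < e -> exists2 C, 0 <= C &
  forall u, 0 <= u -> `|P.[u]| <= C * expR (e * u).
Proof.
move=> e0; exists (\sum_(i < size P) `|P`_i| * (i`!%:R / e ^+ i)).
  by apply: sumr_ge0 => i _; rewrite mulr_ge0 // divr_ge0 // exprn_ge0 // ltW.
move=> u u0; rewrite horner_coef big_distrl /=.
apply: le_trans (ler_norm_sum _ _ _) _; apply: ler_sum => i _.
rewrite normrM -mulrA ler_wpM2l // normrX (ger0_norm u0).
have := @exp_ge_pow_fact (e * u) i; rewrite mulr_ge0 ?(ltW e0)// => /(_ isT).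
rewrite ler_pdivrMr ?ltr0n ?fact_gt0 // => H.
by rewrite mulrAC ler_pdivlMr ?exprn_gt0 // mulrC -exprMn [leRHS]mulrC.
Qed.

Lemma poly_upto_weaken g P d d' : d' <= d -> poly_upto g P d -> poly_upto g P d'.
Proof.
move=> dd' [C C0 H]; exists C => // u u0; apply: le_trans (H u u0) _.
by rewrite ler_wpM2l // ler_expR ler_wpM2r // lerN2.
Qed.

Lemma almost_poly_ext g g' : (forall u, 0 <= u -> g u = g' u) ->
  almost_poly g -> almost_poly g'.
Proof.
move=> gg' [P [d [d0 [C C0 H]]]]; exists P, d; split => //.
by exists C => // u u0; rewrite -gg' // H.
Qed.

Lemma almost_poly_horner P : almost_poly (horner P).
Proof.
exists P, 1; split => //; exists 0 => // u _.
by rewrite subrr normr0 mul0r.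
Qed.

Lemma almost_poly_small g d C : 0 < d ->
  (forall u, 0 <= u -> `|g u| <= C * expR (- d * u)) -> almost_poly g.
Proof.
move=> d0 H; exists 0, d; split => //; exists C.
  by have := H 0 (lexx _); rewrite mulr0 expR0 mulr1; apply: le_trans.
by move=> u u0; rewrite horner0 subr0 H.
Qed.

Lemma almost_polyD g g' : almost_poly g -> almost_poly g' ->
  almost_poly (fun u => g u + g' u).
Proof.
move=> [P [d [d0 H]]] [P' [d' [d'0 H']]]; exists (P + P'), (Num.min d d').
rewrite lt_min d0 d'0; split => //.
have emd : Num.min d d' <= d by rewrite ge_min lexx.
have emd' : Num.min d d' <= d' by rewrite ge_min lexx orbT.
have [C C0 {}H] := @poly_upto_weaken _ _ _ (Num.min d d') emd H.
have [C' C'0 {}H'] := @poly_upto_weaken _ _ _ (Num.min d d') emd' H'.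
exists (C + C'); first exact: addr_ge0.
move=> u u0; rewrite hornerD opprD addrACA mulrDl.
by apply: le_trans (ler_normD _ _) _; rewrite lerD ?H ?H'.
Qed.

Lemma almost_polyM g g' : almost_poly g -> almost_poly g' ->
  almost_poly (fun u => g u * g' u).
Proof.
move=> [P [d [d0 [C C0 H]]]] [P' [d' [d'0 [C' C'0 H']]]].
set e := Num.min d d'; have e0 : 0 < e by rewrite lt_min d0 d'0.
have e20 : 0 < e / 2 by rewrite divr_gt0.
have [D D0 HD] := poly_le_exp P e20; have [D' D'0 HD'] := poly_le_exp P' e20.
exists (P * P'), (e / 2); split=> //.
exists (C * C' + C * D' + D * C'); first by rewrite !addr_ge0 ?mulr_ge0.
move=> u u0; rewrite hornerM.
rewrite (_ : _ - _ = (g u - P.[u]) * (g' u - P'.[u]) + (g u - P.[u]) * P'.[u]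
   + P.[u] * (g' u - P'.[u])); last by ring.
have le1 (x : R) : e / 2 <= x -> expR (- x * u) <= expR (- (e / 2) * u).
  by move=> ex; rewrite ler_expR ler_wpM2r // lerN2.
have ed : e <= d by rewrite ge_min lexx.
have ed' : e <= d' by rewrite ge_min lexx orbT.
have H2 := H u u0; have H2' := H' u u0.
rewrite [leRHS]mulrDl [X in _ <= X + _]mulrDl; apply: le_trans (ler_normD _ _) _; apply: lerD.
  apply: le_trans (ler_normD _ _) _; apply: lerD; rewrite normrM.
    apply: le_trans (ler_pM (normr_ge0 _) (normr_ge0 _) H2 H2') _.
    rewrite mulrACA -expRD ler_wpM2l ?mulr_ge0 // -mulrDl -opprD le1 //.
    lra.
  apply: le_trans (ler_pM (normr_ge0 _) (normr_ge0 _) H2 (HD' _ u0)) _.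
  rewrite mulrACA -expRD ler_wpM2l ?mulr_ge0 // -mulrDl.
  rewrite ler_expR ler_wpM2r //; lra.
rewrite normrM; apply: le_trans (ler_pM (normr_ge0 _) (normr_ge0 _) (HD _ u0) H2') _.
rewrite mulrACA -expRD ler_wpM2l ?mulr_ge0 // -mulrDl.
rewrite ler_expR ler_wpM2r //; lra.
Qed.

Lemma almost_poly_sum (I : Type) (r : seq I) (F : I -> R -> R) :
  (forall i, almost_poly (F i)) -> almost_poly (fun u => \sum_(i <- r) F i u).
Proof.
move=> HF; elim: r => [|i r IH].
  apply: almost_poly_ext (almost_poly_horner 0) => u _.
  by rewrite big_nil horner0.
by apply: almost_poly_ext (almost_polyD (HF i) IH) => u _; rewrite big_cons.
Qed.

Lemma almost_poly_half g : almost_poly g -> almost_poly (fun u => g (u / 2)).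
Proof.
move=> [P [d [d0 [C C0 H]]]]; exists (P \Po (2^-1 *: 'X)), (d / 2).
split; first by rewrite divr_gt0.
exists C => // u u0; rewrite horner_comp !hornerE.
have := H (u / 2); rewrite divr_ge0 // => /(_ isT).
rewrite [2^-1 * u]mulrC; congr (_ <= _ * expR _).
by field.
Qed.

(** A function whose increments are exponentially small converges at infinity,
    exponentially fast. *)
Lemma poly_upto_cauchy g d D : 0 < d ->
  (forall a b, 0 <= a <= b -> `|g b - g a| <= D * expR (- d * a)) ->
  exists l : R, forall u, 0 <= u -> `|g u - l| <= D * expR (- d * u).
Proof.
move=> d0 H.
have D0 : 0 <= D.
  by have := H 0 0; rewrite !lexx mulr0 expR0 mulr1 => /(_ isT); apply: le_trans.
have lim0 : (fun n : nat => D * expR (- d * n%:R)) @ \oo --> (0 : R).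
  rewrite -[X in _ --> X](mulr0 D); apply: cvgMl_tmp.
  have -> : (fun n : nat => expR (- d * n%:R) : R) = (fun n : nat => expR (- d) ^+ n).
    by apply/funext => n; rewrite expRM_natr.
  apply: cvg_expr; rewrite ger0_norm ?expR_ge0 //.
  by rewrite expR_lt1 oppr_lt0.
have cv : cvgn (fun n : nat => g n%:R).
  apply/cauchy_cvgP/cauchy_exP => e e0.
  have /cvgrPdist_lt/(_ e e0)[N _ HN] := lim0.
  exists (g N%:R), N => // n /= Nn.
  have := HN N (leqnn N); rewrite /= sub0r normrN ger0_norm ?mulr_ge0 ?expR_ge0 // => h.
  rewrite -ball_normE /ball_ /= distrC; apply: le_lt_trans h; apply: H.
  by rewrite ler0n ler_nat.
exists (limn (fun n : nat => g n%:R)) => u u0.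
have cvl : (fun n : nat => `|g u - g n%:R|) @ \oo --> `|g u - limn (fun n : nat => g n%:R)|.
  apply: cvg_norm; apply: cvgB => //; exact: cvg_cst.
apply: (cvgr_to_le cvl).
near=> n.
rewrite distrC; apply: H; rewrite u0 /=.
near: n.
exact: nbhs_infty_ger.
Unshelve. all: by end_near.
Qed.

Lemma almost_poly_cauchy g d D : 0 < d ->
  (forall a b, 0 <= a <= b -> `|g b - g a| <= D * expR (- d * a)) ->
  almost_poly g.
Proof.
move=> d0 /(poly_upto_cauchy d0)[l Hl]; exists l%:P, d; split => //; exists D.
  have := Hl 0 (lexx _); rewrite mulr0 expR0 mulr1; exact: le_trans.
by move=> u u0; rewrite hornerC Hl.
Qed.

End AlmostPoly.

(** * Weighted partial sums and real Dirichlet series near the abscissa *)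

Section Twist.
Context {R : realType}.
Implicit Types (P Q W : {poly R}) (d e u : R).

Lemma is_derive_exp_poly (k : R) W (x : R) :
  is_derive x 1 (fun v => expR (k * v) * W.[v])
    (expR (k * x) * (W^`() + k *: W).[x]).
Proof.
have d1 : is_derive x 1 (fun v : R => k * v) k.
  by apply: is_derive_eq; rewrite -/(k *: (1 : R)) [_ *: _]mulr1.
have d2 : is_derive x 1 (fun v => expR (k * v)) (k * expR (k * x)).
  by rewrite mulrC; exact: (@is_derive1_comp _ expR).
apply: (is_derive_eq (is_deriveM d2 (is_derive_poly W x))).
rewrite !hornerE /GRing.scale /=; ring.
Qed.

Lemma is_derive_expc (c k x : R) :
  is_derive x 1 (fun v => c * expR (k * v)) (c * k * expR (k * x)).
Proof.
have := is_derive_exp_poly k c%:P x.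
rewrite derivC add0r hornerZ hornerC (_ : (fun v => _) = (fun v : R => c * expR (k * v))).
  by move=> H; apply: (is_derive_eq H); ring.
by apply/funext => v; rewrite hornerC mulrC.
Qed.

Lemma poly_antideriv P : exists Q, Q^`() = P.
Proof.
exists (\poly_(i < (size P).+1) (P`_i.-1 / i%:R)); apply/polyP => i.
rewrite coef_deriv coef_poly ltnS; case: ltnP => [_|Pi]; last first.
  by rewrite mul0rn nth_default.
by rewrite /= -[LHS]mulr_natr divfK // pnatr_eq0.
Qed.

(** The sum of [P_k k! / t^(k+1)], that is, the Laplace transform of [P]
    at [t]. *)
Definition polar P (t : R) : R := \sum_(k < size P) P`_k * k`!%:R / t ^+ k.+1.

(** [exp (- t v) Q(v)] is a primitive of [- exp (- t v) P(v)], and its value at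
    0 is the Laplace transform: [Q] is the sum of the [P^(k) / t^(k+1)]. *)
Lemma poly_laplace P (t : R) : t != 0 ->
  exists Q, Q^`() + (- t) *: Q = - P /\ Q.[0] = polar P t.
Proof.
move=> t0; exists (\sum_(k < size P) (t ^+ k.+1)^-1 *: P^`(k)); split; last first.
  rewrite horner_sum; apply: eq_bigr => k _.
  rewrite hornerZ horner_coef0 coef_derivn addn0 ffactnn -[P`_k *+ _]mulr_natr mulrC.
  by [].
rewrite scaler_sumr linear_sum -big_split /=.
have -> : - P = P^`(size P) - P by rewrite derivn_poly0 // sub0r.
transitivity (\sum_(k < size P) ((t ^+ k.+1)^-1 *: P^`(k.+1) - (t ^+ k)^-1 *: P^`(k))).
  apply: eq_bigr => k _; rewrite derivZ -derivnS scalerA; congr (_ + _).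
  rewrite -scaleNr; congr (_ *: _); rewrite exprS invfM mulrA mulNr divff //.
  by rewrite mulN1r.
rewrite -(big_mkord xpredT (fun k => (t ^+ k.+1)^-1 *: P^`(k.+1) - (t ^+ k)^-1 *: P^`(k))).
rewrite (telescope_sumr (fun k => (t ^+ k)^-1 *: P^`(k))) // derivn0 expr0 invr1 scale1r.
congr (_ - _).
by rewrite derivn_poly0 // scaler0.
Qed.

Context {T : choiceType}.
Implicit Type h : T -> R.

(** The normalised counting function [exp (- alpha u) cnt h u]. *)
Definition ncnt (alpha : R) h (u : R) : R := expR (- alpha * u) * cnt h u.

(** If the normalised counting function is almost polynomial, so are the
    partial sums of [exp (- alpha h) W(h)]; this is Abel summation, where the
    antiderivative [Th] of [P * (W' - alpha W)] is a polynomial. *)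
Lemma twisted_almost_poly (alpha : R) h W : loc_fin h ->
  almost_poly (ncnt alpha h) ->
  almost_poly (psum h (fun t => expR (- alpha * h t) * W.[h t])).
Proof.
move=> hfin hm; have [P [d [d0 [C C0 HP]]]] := hm.
(* phi' v = exp (- alpha v) K(v) *)
pose phi v := expR (- alpha * v) * W.[v].
pose K := W^`() + (- alpha) *: W.
have [Th ThE] := poly_antideriv (P * K).
have d20 : 0 < d / 2 by rewrite divr_gt0.
have [D D0 HD] := poly_le_exp K d20.
pose c := 2 * (C * D) / d.
have c0 : 0 <= c by rewrite divr_ge0 ?mulr_ge0 // ltW.
have step a b : 0 <= a <= b ->
  `|abelI h phi (horner Th) b - abelI h phi (horner Th) a| <= c * expR (- (d / 2) * a).
  move=> /andP[a0 ab].
  have dphi (x : R) := is_derive_exp_poly (- alpha) W x.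
  have dTh (x : R) : is_derive x 1 (horner Th) (P * K).[x].
    by rewrite -ThE; exact: is_derive_poly.
  have dLa (x : R) := is_derive_expc (- c) (- (d / 2)) x.
  apply: le_trans (abelI_increment hfin ab dphi dTh dLa _) _.
    move=> v /andP[av vb]; have v0 : 0 <= v by rewrite (le_trans a0) // ltW.
    rewrite (_ : _ - _ = (ncnt alpha h v - P.[v]) * K.[v]); last first.
      by rewrite /ncnt -/K hornerM; ring.
    rewrite normrM; apply: le_trans (ler_pM _ _ (HP v v0) (HD v v0)) _ => //.
    rewrite mulrACA -expRD le_eqVlt; apply/orP; left; apply/eqP.
    congr (_ * expR _); last by field.
    by rewrite /c; field; rewrite gt_eqF.
  by rewrite !mulNr opprK gerDr oppr_le0 mulr_ge0 ?expR_ge0.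
have hI := almost_poly_cauchy d20 step.
have h1 := almost_polyM (almost_poly_horner W) hm.
have h2 := almost_polyM (almost_poly_horner (- 1)) hI.
have h3 := almost_poly_horner (- Th).
apply: almost_poly_ext (almost_polyD (almost_polyD h1 h2) h3) => u u0.
rewrite abelIE hornerN hornerN hornerC /ncnt /phi.
rewrite (_ : psum h (phi \o h) u = psum h (fun t => expR (- alpha * h t) * W.[h t]) u) //.
ring.
Qed.

Lemma near_exp_small (C k : R) : 0 < k ->
  \forall v \near +oo, C * expR (- k * v) <= 1.
Proof.
move=> k0; near=> v.
rewrite mulNr expRN ler_pdivrMr ?expR_gt0 // mul1r.
apply: le_trans (expR_ge1Dx _).
by rewrite -lerBlDl -ler_pdivrMl.
Unshelve. all: by end_near.
Qed.

(** Close to the right of [alpha] the partial sums of the Dirichlet series end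
    up at a distance from [(alpha + t) * polar P t] which is bounded uniformly
    in [t]: the error term contributes a regular function. *)
Lemma psum_exp_polar (alpha : R) h P d : 0 <= alpha -> loc_fin h -> 0 < d ->
  poly_upto (ncnt alpha h) P d ->
  exists B : R, forall t : R, 0 < t <= 1 -> \forall v \near +oo,
    `|psum h (fun x => expR (- (alpha + t) * h x)) v - (alpha + t) * polar P t| <= B.
Proof.
move=> alpha0 hfin d0 [C C0 HP].
pose B0 := psum h (fun x => 1 + expR ((alpha + 1) * `|h x|)) 0.
(* 2 for two terms that tend to 0, (alpha + 1) * C / d for the error term of the
   counting function, B0 for the finitely many members of h below 0 *)
exists (2 + (alpha + 1) * C / d + B0) => t /andP[t0 t1].
pose s := alpha + t.
have s0 : 0 < s by rewrite ltr_wpDl.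
have [Q [dQ Q0]] := @poly_laplace P t (lt0r_neq0 t0).
pose phi v := expR (- s * v); pose Th v := expR (- t * v) * (s *: Q).[v].
have dphi (x : R) : is_derive x 1 phi (- s * expR (- s * x)).
  have := is_derive_expc 1 (- s) x; rewrite mul1r; congr (is_derive _ _ _ _).
  by apply/funext => v; rewrite mul1r.
have dTh (x : R) : is_derive x 1 Th (- s * (expR (- t * x) * P.[x])).
  have := is_derive_exp_poly (- t) (s *: Q) x.
  congr (is_derive _ _ _ _).
  have -> : (s *: Q)^`() + - t *: (s *: Q) = s *: (Q^`() + (- t) *: Q).
    by rewrite derivZ scalerDr !scalerA [s * _]mulrC.
  rewrite dQ hornerZ hornerN; ring.
pose c := s * C / d.
have c0 : 0 <= c by rewrite divr_ge0 ?mulr_ge0 // ltW.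
have dLa (x : R) := is_derive_expc (- c) (- d) x.
have step v : 0 <= v -> `|abelI h phi Th v - abelI h phi Th 0| <= c.
  move=> v0; apply: le_trans (abelI_increment hfin v0 dphi dTh dLa _) _; last first.
    by rewrite mulr0 expR0 mulr1 opprK gerDr mulNr oppr_le0 mulr_ge0 ?expR_ge0.
  move=> x /andP[x0 xv].
  rewrite (_ : _ - _ = - s * expR (- t * x) * (ncnt alpha h x - P.[x])); last first.
    rewrite /ncnt (_ : expR (- s * x) = expR (- t * x) * expR (- alpha * x)); first ring.
    by rewrite -expRD; congr expR; rewrite /s; ring.
  rewrite !normrM normrN (ger0_norm (ltW s0)) (ger0_norm (expR_ge0 _)).
  rewrite (_ : - c * - d * expR (- d * x) = s * 1 * (C * expR (- d * x))); last first.
    by rewrite /c; field; rewrite gt_eqF.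
  apply: ler_pM (HP x (ltW x0)) => //; first by rewrite mulr_ge0 ?expR_ge0 // ltW.
  rewrite ler_wpM2l ?(ltW s0) // -expR0 ler_expR mulNr oppr_le0 mulr_ge0 // ltW //.
have t20 : 0 < t / 2 by rewrite divr_gt0.
have [D D0 HD] := poly_le_exp (P - s *: Q) t20.
have start : `|psum h (fun x => phi 0 - phi (h x)) 0| <= B0.
  apply: le_trans (ler_norm_psum _ _ _) _; apply: ler_psum => // x _.
  apply: le_trans (ler_normB _ _) _; rewrite /phi !(ger0_norm (expR_ge0 _)).
  rewrite mulr0 expR0 lerD2l ler_expR; apply: le_trans (ler_norm _) _.
  rewrite normrM; apply: ler_wpM2r => //.
  by rewrite normrN ger0_norm ?(ltW s0) // lerD2l.
near=> v.
have v0 : 0 <= v by near: v; apply: nbhs_pinfty_ge; rewrite num_real.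
have cc : c <= (alpha + 1) * C / d.
  by rewrite /c ler_pM2r ?invr_gt0 //; apply: ler_wpM2r => //; rewrite lerD2l.
have bI := step v v0.
have E1 : abelI h phi Th v = expR (- t * v) * ncnt alpha h v -
    psum h (fun x => expR (- s * h x)) v - expR (- t * v) * (s * Q.[v]).
  rewrite abelIE /Th hornerZ; congr (_ - _ - _).
  rewrite /ncnt /phi mulrA -expRD mulrC; congr (expR _ * _).
  by rewrite /s; ring.
have E2 : abelI h phi Th 0 = psum h (fun x => phi 0 - phi (h x)) 0 - s * polar P t.
  by rewrite /abelI /Th mulr0 expR0 mul1r hornerZ Q0.
have E3 : psum h (fun x => expR (- s * h x)) v - s * polar P t =
  expR (- t * v) * (ncnt alpha h v - P.[v]) + expR (- t * v) * (P - s *: Q).[v]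
  - (abelI h phi Th v - abelI h phi Th 0) - psum h (fun x => phi 0 - phi (h x)) 0.
  by rewrite E1 E2 hornerD hornerN hornerZ; ring.
rewrite -/s E3.
have b1 : `|expR (- t * v) * (ncnt alpha h v - P.[v])| <= 1.
  rewrite normrM ger0_norm ?expR_ge0 //.
  apply: (@le_trans _ _ (C * expR (- d * v))).
    rewrite -[leRHS]mul1r; apply: ler_pM (HP v v0) => //.
    by rewrite -expR0 ler_expR mulNr oppr_le0 mulr_ge0 // ltW.
  near: v; exact: near_exp_small.
have b2 : `|expR (- t * v) * (P - s *: Q).[v]| <= 1.
  rewrite normrM ger0_norm ?expR_ge0 //.
  apply: (@le_trans _ _ (D * expR (- (t / 2) * v))).
    rewrite (_ : - (t / 2) * v = - t * v + t / 2 * v); last by field.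
    rewrite expRD mulrCA ler_wpM2l ?expR_ge0 //; exact: HD.
  near: v; exact: near_exp_small.
apply: le_trans (ler_normB _ _) _; apply: lerD; last exact: start.
apply: le_trans (ler_normB _ _) _; apply: lerD; last exact: le_trans cc.
by apply: le_trans (ler_normD _ _) _; apply: le_trans (lerD b1 b2) _; lra.
Unshelve. all: by end_near.
Qed.

End Twist.

(** * Products of two families: the hyperbola method *)

Section Products.
Context {R : realType} {T U : choiceType}.
Implicit Types (h : T -> R) (g : U -> R).

(** The family of all sums of a member of [h] and a member of [g]. *)
Definition hadd h g (x : T * U) : R := h x.1 + g x.2.

Lemma loc_fin_lb (S : choiceType) (h : S -> R) : loc_fin h ->
  exists c, forall t, c <= h t.
Proof.
move=> hfin; exists (- psum h (fun t => `|h t|) 0) => t.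
have [ht0|/ltW ht0] := leP (h t) 0; last first.
  by apply: le_trans ht0; rewrite oppr_le0 psum_ge0.
rewrite lerNl -(ler0_norm ht0) /psum.
rewrite (bigD1_seq t) ?fset_uniq //=; last by rewrite in_fset_set // inE.
by rewrite lerDl sumr_ge0.
Qed.

Lemma psum_hadd {V : nmodType} h g (c : T * U -> V) u X Y : loc_fin h -> loc_fin g ->
  (forall t t', h t + g t' <= u -> h t <= X /\ g t' <= Y) ->
  psum (hadd h g) c u =
    \sum_(t <- fset_set [set t | h t <= X])
      \sum_(t' <- fset_set [set t | g t <= Y] | h t + g t' <= u) c (t, t').
Proof.
move=> hfin gfin XY.
rewrite (@psum_seq _ _ _ _ c u
  [seq (t, t') | t <- fset_set [set t | h t <= X], t' <- fset_set [set t | g t <= Y]]).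
- by rewrite big_mkcond big_allpairs_dep /=; under eq_bigr do rewrite -big_mkcond.
- by apply: allpairs_uniq => [||[? ?] [? ?]]; rewrite ?fset_uniq.
move=> [t t'] /= /XY[tX t'Y]; apply/allpairsP; exists (t, t').
by rewrite !in_fset_set // !inE.
Qed.

Lemma hadd_bounds h g u : loc_fin h -> loc_fin g ->
  exists X, forall t t', h t + g t' <= u -> h t <= X /\ g t' <= X.
Proof.
move=> /loc_fin_lb[c hc] /loc_fin_lb[c' gc'].
exists (Num.max (u - c) (u - c')) => t t' htg; rewrite !le_max.
by move: (hc t) (gc' t'); split; apply/orP; [right|left]; lra.
Qed.

Lemma loc_fin_hadd h g : loc_fin h -> loc_fin g -> loc_fin (hadd h g).
Proof.
move=> hfin gfin u; have [X HX] := hadd_bounds u hfin gfin.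
apply: sub_finite_set (finite_setX (hfin X) (gfin X)) => -[t t'] /= /HX[? ?].
by split.
Qed.

(** If [a + b <= u] then [a <= u / 2] or [b <= u / 2]; the last product counts
    the pairs for which both hold. *)
Lemma hyperbola h g (u : R) : loc_fin h -> loc_fin g ->
  cnt (hadd h g) u = psum g (fun t' => cnt h (u - g t')) (u / 2)
    + psum h (fun t => cnt g (u - h t)) (u / 2) - cnt h (u / 2) * cnt g (u / 2).
Proof.
move=> hfin gfin; have [X0 HX0] := hadd_bounds u hfin gfin.
pose X := Num.max X0 (u / 2).
have uX : u / 2 <= X by rewrite le_max lexx orbT.
have HX t t' : h t + g t' <= u -> h t <= X /\ g t' <= X.
  by move=> /HX0[? ?]; rewrite !le_max; split; apply/orP; left.
pose L := fset_set [set t | h t <= X]; pose L' := fset_set [set t | g t <= X].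
have cL t' : cnt h (u - g t') = \sum_(t <- L) ((h t + g t' <= u)%R : nat)%:R.
  rewrite /cnt (@psum_seq _ _ _ _ _ _ L) ?fset_uniq //.
    by rewrite big_mkcond; apply: eq_bigr => t _; rewrite lerBrDr; case: ifP.
  by move=> t; rewrite lerBrDr => /HX[? _]; rewrite in_fset_set // inE.
have cL' t : cnt g (u - h t) = \sum_(t' <- L') ((h t + g t' <= u)%R : nat)%:R.
  rewrite /cnt (@psum_seq _ _ _ _ _ _ L') ?fset_uniq //.
    by rewrite big_mkcond; apply: eq_bigr => t' _; rewrite lerBrDr addrC; case: ifP.
  by move=> t'; rewrite lerBrDr addrC => /HX[_ ?]; rewrite in_fset_set // inE.
rewrite {1}/cnt (psum_hadd _ hfin gfin HX) -/L -/L'.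
rewrite (psum_widen _ gfin uX) -/L' (psum_widen _ hfin uX) -/L.
rewrite /cnt (psum_widen _ hfin uX) (psum_widen _ gfin uX) -/L -/L'.
rewrite (big_mkcond (fun t => g t <= u / 2)) (big_mkcond (fun t => h t <= u / 2)) /=.
rewrite (eq_bigr (fun t' => \sum_(t <- L) ((g t' <= u / 2)%R && (h t + g t' <= u)%R : nat)%:R)); last first.
  move=> t' _; case: ifP => _ /=; first exact: cL.
  by rewrite big1.
rewrite exchange_big /=.
rewrite [X in _ = _ + X - _](eq_bigr (fun t => \sum_(t' <- L') ((h t <= u / 2)%R && (h t + g t' <= u)%R : nat)%:R)); last first.
  move=> t _; case: ifP => _ /=; first exact: cL'.
  by rewrite big1.
rewrite [X in _ = _ + _ - X * _]big_mkcond [X in _ = _ + _ - _ * X]big_mkcond /=.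
rewrite big_distrl /= -big_split -sumrB /=; apply: eq_bigr => t _.
rewrite big_distrr /= -big_split -sumrB /= big_mkcond; apply: eq_bigr => t' _.
case: (leP (h t) (u / 2)) => ht; case: (leP (g t') (u / 2)) => gt /=;
  case: (leP (h t + g t') u) => htg; rewrite /= ?mulr1 ?mulr0; lra.
Qed.

(** One of the two sums of the hyperbola method, after normalisation.  The main
    part is expanded by Taylor's formula into products of polynomials in [u] and
    of weighted partial sums at [u / 2].  The error is bounded by Rankin's trick:
    for the members of [g] below [u / 2], the weight [exp (- alpha g)] is traded
    for [exp (- (alpha + e) g)] with a small [e > 0], whose partial sums are
    bounded. *)
Lemma almost_poly_half_hyperbola (alpha : R) h g : 0 <= alpha ->
  loc_fin h -> loc_fin g ->
  almost_poly (ncnt alpha h) -> almost_poly (ncnt alpha g) ->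
  almost_poly (fun u => psum g (fun t => expR (- alpha * g t) * ncnt alpha h (u - g t)) (u / 2)).
Proof.
move=> alpha0 hfin gfin [P [d [d0 [C C0 HP]]]] mg.
pose main u := psum g (fun t => expR (- alpha * g t) * P.[u - g t]) (u / 2).
have mainE : almost_poly main.
  apply: (@almost_poly_ext _ (fun u => \sum_(k < size P)
     (P^`N(k)).[u] * psum g (fun t => expR (- alpha * g t) * ((-1) ^+ k *: 'X^k).[g t]) (u / 2))).
    move=> u u0; rewrite /main /psum.
    under eq_bigr do rewrite big_distrr.
    rewrite exchange_big /=; apply: eq_bigr => t _.
    rewrite nderiv_taylor; last exact: mulrC.
    rewrite big_distrr /=; apply: eq_bigr => k _.
    by rewrite hornerZ hornerXn -exprMn mulN1r; ring.
  apply: almost_poly_sum => k; apply: almost_polyM; first exact: almost_poly_horner.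
  exact/almost_poly_half/twisted_almost_poly.
have [Pg [dg [dg0 Hg]]] := mg.
have [B HB] := psum_exp_polar alpha0 gfin dg0 Hg.
(* t <= d / 2 leaves the error exponentially small; t <= 1 is needed to
   bound the Dirichlet series *)
pose t := Num.min (d / 2) 1.
have t0 : 0 < t by rewrite lt_min divr_gt0 ?ltr01.
have td : t <= d / 2 by rewrite ge_min lexx.
pose S := B + `|(alpha + t) * polar Pg t|.
have HS y : psum g (fun x => expR (- (alpha + t) * g x)) y <= S.
  have t01 : 0 < t <= 1 by rewrite t0 ge_min lexx orbT.
  near +oo_R => v.
  apply: (@le_trans _ _ (psum g (fun x => expR (- (alpha + t) * g x)) v)).
    by apply: psum_mono => // x; exact: expR_ge0.
  have : `|psum g (fun x => expR (- (alpha + t) * g x)) v - (alpha + t) * polar Pg t| <= B.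
    by near: v; exact: HB.
  move/(le_trans (lerB_dist _ _)) => hB.
  rewrite /S -lerBlDr; apply: le_trans hB; rewrite lerD2r ler_norm //.
have S0 : 0 <= S by apply: le_trans (HS 0); apply: psum_ge0 => ?; exact: expR_ge0.
have err : almost_poly (fun u => psum g (fun t => expR (- alpha * g t) * ncnt alpha h (u - g t)) (u / 2) - main u).
  apply: (@almost_poly_small _ _ ((d - t) / 2) (C * S)); first by rewrite divr_gt0 // subr_gt0; lra.
  move=> u u0.
  rewrite (_ : _ - _ = psum g (fun t => expR (- alpha * g t) * (ncnt alpha h (u - g t) - P.[u - g t])) (u / 2)); last first.
    by rewrite /main /psum -sumrB; apply: eq_bigr => x _; rewrite mulrBr.
  apply: le_trans (ler_norm_psum _ _ _) _.
  apply: (@le_trans _ _ (psum g (fun x => C * expR (- ((d - t) / 2) * u) * expR (- (alpha + t) * g x)) (u / 2))).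
    apply: ler_psum => // x gx; rewrite normrM (ger0_norm (expR_ge0 _)).
    have ug : 0 <= u - g x by lra.
    apply: (@le_trans _ _ (expR (- alpha * g x) * (C * expR (- d * (u - g x))))).
      by apply: ler_wpM2l (HP _ ug); exact: expR_ge0.
    rewrite mulrCA -mulrA -!expRD; apply: ler_wpM2l => //; rewrite ler_expR.
    have : 0 <= (d + t) * (u / 2 - g x) by rewrite mulr_ge0 ?subr_ge0 // addr_ge0 // ltW.
    lra.
  rewrite (_ : psum _ _ _ = C * expR (- ((d - t) / 2) * u) * psum g (fun x => expR (- (alpha + t) * g x)) (u / 2)); last first.
    by rewrite /psum big_distrr.
  by rewrite mulrAC; apply: ler_wpM2r; [exact: expR_ge0 | apply: ler_wpM2l].
apply: almost_poly_ext (almost_polyD err mainE) => u u0.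
by rewrite subrK.
Unshelve. all: by end_near.
Qed.

End Products.

Lemma almost_poly_hadd (R : realType) (T U : choiceType) (alpha : R)
    (h : T -> R) (g : U -> R) : 0 <= alpha -> loc_fin h -> loc_fin g ->
  almost_poly (ncnt alpha h) -> almost_poly (ncnt alpha g) ->
  almost_poly (ncnt alpha (hadd h g)).
Proof.
move=> alpha0 hfin gfin mh mg.
have H1 := almost_poly_half_hyperbola alpha0 hfin gfin mh mg.
have H2 := almost_poly_half_hyperbola alpha0 gfin hfin mg mh.
have H3 := almost_polyM (almost_poly_horner (- 1))
  (almost_polyM (almost_poly_half mh) (almost_poly_half mg)).
apply: almost_poly_ext (almost_polyD (almost_polyD H1 H2) H3) => u u0.
rewrite [RHS]/ncnt hyperbola // mulrBr mulrDr hornerN hornerC /ncnt mulN1r.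
congr (_ + _ - _).
- rewrite /psum big_distrr /=; apply: eq_bigr => t _.
  by rewrite mulrA -expRD; congr (expR _ * _); ring.
- rewrite /psum big_distrr /=; apply: eq_bigr => t _.
  by rewrite mulrA -expRD; congr (expR _ * _); ring.
by rewrite mulrACA -expRD; congr (expR _ * _); field.
Qed.

(** * Real Dirichlet series of finite products *)

Section DirichletSums.
Context {R : realType}.

(** [d] is the sum of the [exp (- s h t)] over all [t].  All terms are positive,
    so this is stated as a supremum of partial sums, independent of any order of
    summation. *)
Definition is_dsum {T : choiceType} (h : T -> R) (s d : R) :=
  (forall v, psum h (fun t => expR (- s * h t)) v <= d) /\
  forall e, 0 < e -> exists v, d - e < psum h (fun t => expR (- s * h t)) v.

Lemma psum_exp_mono {T : choiceType} (h : T -> R) (s u v : R) : loc_fin h ->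
  u <= v -> psum h (fun t => expR (- s * h t)) u <= psum h (fun t => expR (- s * h t)) v.
Proof. by move=> hfin uv; apply: psum_mono => // t; exact: expR_ge0. Qed.

Lemma psum_exp_ge0 {T : choiceType} (h : T -> R) (s u : R) :
  0 <= psum h (fun t => expR (- s * h t)) u.
Proof. by apply: psum_ge0 => t; exact: expR_ge0. Qed.

Lemma is_dsum_hadd {T U : choiceType} (h : T -> R) (g : U -> R) (s a b : R) :
  loc_fin h -> loc_fin g -> is_dsum h s a -> is_dsum g s b ->
  is_dsum (hadd h g) s (a * b).
Proof.
move=> hfin gfin [ha1 ha2] [gb1 gb2].
have a0 : 0 <= a by apply: le_trans (ha1 0); exact: psum_exp_ge0.
have b0 : 0 <= b by apply: le_trans (gb1 0); exact: psum_exp_ge0.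
have prodE v w : psum h (fun t => expR (- s * h t)) v * psum g (fun t => expR (- s * g t)) w =
  \sum_(t <- fset_set [set t | h t <= v]) \sum_(t' <- fset_set [set t | g t <= w])
    expR (- s * hadd h g (t, t')).
  rewrite /psum big_distrl /=; apply: eq_bigr => t _.
  rewrite big_distrr /=; apply: eq_bigr => t' _.
  by rewrite -expRD -mulrDr.
split.
  move=> v; have [X HX] := hadd_bounds v hfin gfin.
  rewrite (psum_hadd _ hfin gfin HX).
  apply: le_trans (ler_pM _ _ (ha1 X) (gb1 X)); try exact: psum_exp_ge0.
  rewrite prodE; apply: ler_sum => t _; rewrite big_mkcond /=.
  by apply: ler_sum => t' _; case: ifP => // _; exact: expR_ge0.
move=> e e0.
pose e' := e / (2 * (a + b + 1)).
have ab0 : 0 < a + b + 1 by rewrite ltr_wpDl // addr_ge0.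
have e'0 : 0 < e' by rewrite divr_gt0 // mulr_gt0.
have [v Hv] := ha2 e' e'0; have [w Hw] := gb2 e' e'0.
exists (v + w).
apply: (@lt_le_trans _ _ (psum h (fun t => expR (- s * h t)) v * psum g (fun t => expR (- s * g t)) w)).
  set A := psum h _ _ in Hv *; set B := psum g _ _ in Hw *.
  have A0 : 0 <= A by exact: psum_exp_ge0.
  have B0 : 0 <= B by exact: psum_exp_ge0.
  have Ba : A <= a by exact: ha1.
  have Bb : B <= b by exact: gb1.
  have h1 : a * b - A * B <= e' * (a + b).
    rewrite (_ : a * b - A * B = (a - A) * b + A * (b - B)); last by ring.
    rewrite (_ : e' * (a + b) = e' * b + a * e'); last by ring.
    apply: lerD; first by apply: ler_wpM2r => //; lra.
    by apply: ler_pM => //; lra.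
  have h2 : e' * (a + b) < e.
    rewrite /e' mulrAC ltr_pdivrMr; last by rewrite mulr_gt0.
    by rewrite ltr_pM2l //; lra.
  lra.
rewrite prodE.
pose L := [seq (t, t') | t <- fset_set [set t | h t <= v], t' <- fset_set [set t | g t <= w]].
have uL : uniq L by apply: allpairs_uniq => [||[? ?] [? ?]]; rewrite ?fset_uniq.
pose M := fset_set [set x | hadd h g x <= v + w].
have LM x : x \in L -> x \in M.
  move=> /allpairsP[[t t'] /= [tv tw ->]].
  move: tv tw; rewrite !in_fset_set //; last exact: loc_fin_hadd.
  by move=> /set_mem /= tv /set_mem /= tw; apply/mem_set; exact: lerD.
have -> : \sum_(t <- fset_set [set t | h t <= v]) \sum_(t' <- fset_set [set t | g t <= w])
    expR (- s * hadd h g (t, t')) = \sum_(i <- L) expR (- s * hadd h g i).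
  by rewrite big_allpairs_dep.
rewrite /psum -/M.
have -> : \sum_(i <- L) expR (- s * hadd h g i) =
    \sum_(i <- M | i \in L) expR (- s * hadd h g i).
  rewrite -[RHS]big_filter; apply: perm_big; apply: uniq_perm => //.
    exact/filter_uniq/fset_uniq.
  by move=> x; rewrite mem_filter; case: (boolP (x \in L)) => // /LM ->.
by rewrite big_mkcond /=; apply: ler_sum => x _; case: ifP => // _; exact: expR_ge0.
Qed.

Lemma is_dsum_polar {T : choiceType} (h : T -> R) (alpha : R) (P : {poly R}) d :
  0 <= alpha -> loc_fin h -> 0 < d -> poly_upto (ncnt alpha h) P d ->
  exists B : R, forall t D : R, 0 < t <= 1 -> is_dsum h (alpha + t) D ->
    `|D - (alpha + t) * polar P t| <= B.
Proof.
move=> alpha0 hfin d0 hP; have [B HB] := psum_exp_polar alpha0 hfin d0 hP.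
exists (B + 1) => t D t01 [D1 D2].
have [v0 Dv0] := D2 1 ltr01.
near +oo_R => v.
have v0v : v0 <= v by near: v; apply: nbhs_pinfty_ge; exact: num_real.
have h1 : `|psum h (fun x => expR (- (alpha + t) * h x)) v - (alpha + t) * polar P t| <= B.
  by near: v; exact: HB.
have h2 := psum_exp_mono (alpha + t) hfin v0v.
have h3 := D1 v.
rewrite (_ : D - _ = (D - psum h (fun x => expR (- (alpha + t) * h x)) v) +
  (psum h (fun x => expR (- (alpha + t) * h x)) v - (alpha + t) * polar P t)); last by ring.
apply: le_trans (ler_normD _ _) _; rewrite (addrC B 1); apply: lerD => //.
rewrite ger0_norm ?subr_ge0 // lerBlDr -lerBlDl.
exact: le_trans (ltW Dv0) h2.
Unshelve. all: by end_near.
Qed.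

Lemma is_dsum_ex {T : choiceType} (h : T -> R) (alpha t : R) (P : {poly R}) d :
  0 <= alpha -> loc_fin h -> 0 < d -> poly_upto (ncnt alpha h) P d ->
  0 < t <= 1 -> exists D, is_dsum h (alpha + t) D.
Proof.
move=> alpha0 hfin d0 hP t01; have [B HB] := psum_exp_polar alpha0 hfin d0 hP.
pose S := range (psum h (fun x => expR (- (alpha + t) * h x))).
have bS v : psum h (fun x => expR (- (alpha + t) * h x)) v <= B + `|(alpha + t) * polar P t|.
  near +oo_R => w.
  have vw : v <= w by near: w; apply: nbhs_pinfty_ge; exact: num_real.
  apply: le_trans (psum_exp_mono _ hfin vw) _.
  have : `|psum h (fun x => expR (- (alpha + t) * h x)) w - (alpha + t) * polar P t| <= B.
    by near: w; exact: HB.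
  move/(le_trans (lerB_dist _ _)) => hB.
  by rewrite -lerBlDr; apply: le_trans hB; rewrite lerD2r ler_norm.
have hS : has_sup S.
  split; first by exists (psum h (fun x => expR (- (alpha + t) * h x)) 0), 0.
  by exists (B + `|(alpha + t) * polar P t|) => _ [v _ <-].
exists (sup S); split=> [v|e e0]; first by apply: sup_upper_bound => //; exists v.
by have [_ [v _ <-] Hv] := sup_adherent e0 hS; exists v.
Unshelve. all: by end_near.
Qed.

Lemma psum_transport {S T : choiceType} {V : nmodType} (e : S -> T) (f : T -> S)
    (h : T -> R) (c : T -> V) u :
  cancel e f -> cancel f e -> loc_fin (h \o e) ->
  psum h c u = psum (h \o e) (c \o e) u.
Proof.
move=> ef fe hfin; rewrite (@psum_seq _ _ _ _ _ _ (map e (fset_set [set t | (h \o e) t <= u]))).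
- rewrite big_map (psum_widen _ hfin (lexx u)) //.
- rewrite map_inj_uniq ?fset_uniq //; exact: can_inj ef.
move=> t ht; apply/mapP; exists (f t); rewrite ?fe // in_fset_set // inE /= fe //.
Qed.

Lemma loc_fin_transport {S T : choiceType} (e : S -> T) (f : T -> S) (h : T -> R) :
  cancel f e -> loc_fin (h \o e) -> loc_fin h.
Proof.
move=> fe hfin u; apply: sub_finite_set (finite_image e (hfin u)) => t /= ht.
by exists (f t); rewrite /= fe.
Qed.

(** The logarithms of the products of one term from each of [n] sequences. *)
Definition hsum n (l : 'I_n -> nat -> R) (k : {ffun 'I_n -> nat}) : R :=
  \sum_(j < n) l j (k j).

(** The case of two families is iterated, splitting off the first sequence. *)
Lemma hsum_almost_poly n (l : 'I_n -> nat -> R) (alpha : R) : 0 < alpha ->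
  (forall j, loc_fin (l j)) -> (forall j, almost_poly (ncnt alpha (l j))) ->
  [/\ loc_fin (hsum l), almost_poly (ncnt alpha (hsum l)) &
    forall s (d : 'I_n -> R), (forall j, is_dsum (l j) s (d j)) ->
      is_dsum (hsum l) s (\prod_(j < n) d j)].
Proof.
move=> alpha0; elim: n l => [|n IHn] l lfin lm.
  (* the empty product: a single index, with logarithm 0 *)
  pose k0 : {ffun 'I_0 -> nat} := [ffun=> 0%N].
  have k0E (k : {ffun 'I_0 -> nat}) : k = k0 by apply/ffunP => -[].
  have l0 k : hsum l k = 0 by rewrite /hsum big_ord0.
  have fin : loc_fin (hsum l).
    by move=> u; apply: (@sub_finite_set _ _ [set k0]) => // k _ /=; rewrite (k0E k).
  have pE c v : psum (hsum l) c v = if 0 <= v then c k0 else 0 :> R.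
    rewrite (@psum_seq _ _ _ _ _ _ [:: k0]) //; last by move=> k _; rewrite (k0E k) inE.
    by rewrite big_mkcond big_seq1 l0.
  split => //.
    apply: (@almost_poly_small _ _ alpha 1) => // u u0.
    by rewrite mul1r /ncnt /cnt pE u0 mulr1 ger0_norm ?expR_ge0.
  move=> s d _; rewrite big_ord0; split=> [v|e e0].
    by rewrite pE; case: ifP => // _; rewrite ?ler01 // l0 mulr0 expR0.
  by exists 0; rewrite pE lexx l0 mulr0 expR0; lra.
pose l' j := l (lift ord0 j).
have [l'fin l'm l'd] := IHn l' (fun j => lfin _) (fun j => lm _).
pose e (x : nat * {ffun 'I_n -> nat}) : {ffun 'I_n.+1 -> nat} :=
  [ffun j => if unlift ord0 j is Some j' then x.2 j' else x.1].
pose f (k : {ffun 'I_n.+1 -> nat}) : nat * {ffun 'I_n -> nat} :=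
  (k ord0, [ffun j => k (lift ord0 j)]).
have ef : cancel e f.
  move=> [a k]; rewrite /e /f ffunE unlift_none /=; congr (_, _).
  by apply/ffunP => j; rewrite !ffunE liftK.
have fe : cancel f e.
  move=> k; apply/ffunP => j; rewrite ffunE.
  by case: unliftP => [j' ->|->] //=; rewrite ffunE.
have hE : hsum l \o e = hadd (l ord0) (hsum l').
  apply/funext => -[a k]; rewrite /hsum /hadd /= big_ord_recl ffunE unlift_none.
  by congr (_ + _); apply: eq_bigr => j _; rewrite ffunE liftK.
have fin' : loc_fin (hsum l \o e) by rewrite hE; exact: loc_fin_hadd.
have pE c u : psum (hsum l) c u = psum (hadd (l ord0) (hsum l')) (c \o e) u :> R.
  by rewrite (psum_transport _ _ ef fe) // hE.
split; first exact: loc_fin_transport fe fin'.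
  have := almost_poly_hadd (ltW alpha0) (lfin ord0) l'fin (lm ord0) l'm.
  by apply: almost_poly_ext => u _; rewrite /ncnt /cnt pE.
move=> s d ld; rewrite big_ord_recl.
have [H1 H2] := is_dsum_hadd (lfin ord0) l'fin (ld ord0) (l'd s _ (fun j => ld (lift ord0 j))).
have eqE v : psum (hsum l) (fun t => expR (- s * hsum l t)) v =
  psum (hadd (l ord0) (hsum l')) (fun t => expR (- s * hadd (l ord0) (hsum l') t)) v.
  by rewrite pE -hE.
split => [v|e0 /H2[v Hv]]; first by rewrite eqE.
by exists v; rewrite eqE.
Qed.

End DirichletSums.

(** * Limits and series of complex numbers *)

(** [toC] is the embedding of the reals as a ring morphism. *)
HB.instance Definition _ (R : realType) :=
  GRing.RMorphism.copy (@toC R) (real_complex R).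

Section ComplexBasics.
Context {R : realType}.
Local Notation K := (Cfield R).
Implicit Types (z w : K).

(** The modulus with real values; the norm of the complex numbers takes its
    values in the complex numbers themselves. *)
Definition cabs z : R := complex.Re `|z|.

Lemma toC_cabs z : toC (cabs z) = `|z|.
Proof. exact: (RRe_real (normr_real (z : R[i]))). Qed.

Lemma toC_inj : injective (@toC R). Proof. by move=> x y []. Qed.

Lemma toC_le (x y : R) : (toC x <= toC y) = (x <= y). Proof. exact: lecR. Qed.
Lemma toC_lt (x y : R) : (toC x < toC y) = (x < y). Proof. exact: ltcR. Qed.

Lemma cabs_lt z (x : R) : (`|z| < toC x) = (cabs z < x).
Proof. by rewrite -toC_cabs toC_lt. Qed.

Lemma toC_gt0 z : 0 < z -> exists2 x : R, 0 < x & z = toC x.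
Proof.
move=> z0; have zE : toC (complex.Re z) = z by exact: RRe_real (gtr0_real z0).
by exists (complex.Re z); rewrite -?toC_lt zE.
Qed.

Lemma cabsM z w : cabs (z * w) = cabs z * cabs w.
Proof. by apply: toC_inj; rewrite rmorphM !toC_cabs normrM. Qed.
Lemma cabsX z n : cabs (z ^+ n) = cabs z ^+ n.
Proof. by apply: toC_inj; rewrite rmorphXn !toC_cabs normrX. Qed.
Lemma cabsN z : cabs (- z) = cabs z.
Proof. by rewrite /cabs normrN. Qed.
Lemma cabsV z : cabs z^-1 = (cabs z)^-1.
Proof. by apply: toC_inj; rewrite fmorphV !toC_cabs normfV. Qed.
Lemma cabsD z w : cabs (z + w) <= cabs z + cabs w.
Proof. by rewrite -toC_le rmorphD !toC_cabs ler_normD. Qed.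
Lemma cabsB z w : cabs (z - w) <= cabs z + cabs w.
Proof. by rewrite -toC_le rmorphD !toC_cabs ler_normB. Qed.
Lemma cabs_toC (x : R) : cabs (toC x) = `|x|.
Proof.
apply: toC_inj; rewrite toC_cabs normc_def /= expr0n /= addr0 sqrtr_sqr.
by [].
Qed.
Lemma cabs0 : cabs 0 = 0. Proof. by rewrite /cabs normr0. Qed.
Lemma cabs1 : cabs 1 = 1. Proof. by rewrite /cabs normr1. Qed.
Lemma cabs_ge0 z : 0 <= cabs z.
Proof. by rewrite -toC_le toC_cabs rmorph0. Qed.
Lemma cabs_eq0 z : (cabs z == 0) = (z == 0).
Proof. by rewrite -(inj_eq toC_inj) toC_cabs rmorph0 normr_eq0. Qed.
Lemma cabs_gt0 z : (0 < cabs z) = (z != 0).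
Proof. by rewrite lt_def cabs_ge0 andbT cabs_eq0. Qed.
Lemma cabs_sum (I : Type) (r : seq I) (P : pred I) (F : I -> K) :
  cabs (\sum_(i <- r | P i) F i) <= \sum_(i <- r | P i) cabs (F i).
Proof.
rewrite -toC_le rmorph_sum /= toC_cabs; apply: le_trans (ler_norm_sum _ _ _) _.
by apply: ler_sum => i _; rewrite toC_cabs.
Qed.
Lemma cabs_Re z : `|complex.Re z| <= cabs z.
Proof. by rewrite -toC_le toC_cabs; exact: normc_ge_Re. Qed.
Lemma cabs_ReIm z : cabs z <= `|complex.Re z| + `|complex.Im z|.
Proof.
case: z => a b /=; rewrite -toC_le toC_cabs normc_def /=.
change (toC (Num.sqrt (a ^+ 2 + b ^+ 2)) <= toC (`|a| + `|b|)).
rewrite toC_le -[leRHS]ger0_norm ?addr_ge0 // -(sqrtr_sqr (`|a| + `|b|)) ler_sqrt ?sqr_ge0 //.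
rewrite sqrrD !real_normK ?num_real // [leRHS]addrAC lerDl.
by rewrite mulrn_wge0 // mulr_ge0.
Qed.

Lemma cvgCP {T : Type} {F : set_system T} {FF : Filter F} (f : T -> K) (l : K) :
  (f x @[x --> F] --> l) <->
  (forall e : R, 0 < e -> \forall x \near F, cabs (l - f x) < e).
Proof.
split => [/cvgrPdist_lt fl e e0|fl].
  have e0' : 0 < toC e by rewrite -(rmorph0 (@toC R)) toC_lt.
  by have := fl _ e0'; apply: filterS => x; rewrite cabs_lt.
apply/cvgrPdist_lt => e /toC_gt0[r r0 ->].
by have := fl _ r0; apply: filterS => x; rewrite cabs_lt.
Qed.

Lemma nearCP (c : K) (P : K -> Prop) : (\forall z \near c, P z) <->
  (exists2 r : R, 0 < r & forall z, cabs (z - c) < r -> P z).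
Proof.
split => [/nbhs_ballP[e /= /toC_gt0[r r0 ->] H]|[r r0 H]].
  by exists r => // z zr; apply: H; rewrite -ball_normE /ball_ /= distrC cabs_lt.
apply/nbhs_ballP; exists (toC r); first by rewrite /= -(rmorph0 (@toC R)) toC_lt.
by move=> z; rewrite -ball_normE /ball_ /= distrC cabs_lt => /H.
Qed.

Lemma cvg_toC {T : Type} {F : set_system T} {FF : Filter F} (f : T -> R) (l : R) :
  f x @[x --> F] --> l -> (fun x => toC (f x)) x @[x --> F] --> toC l.
Proof.
move=> /cvgrPdist_lt fl; apply/cvgCP => e e0.
have := fl _ e0; apply: filterS => x.
by rewrite -rmorphB cabs_toC.
Qed.

Lemma cvg_complex {T : Type} {F : set_system T} {FF : Filter F} (f : T -> K) (a b : R) :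
  complex.Re (f x) @[x --> F] --> a -> complex.Im (f x) @[x --> F] --> b ->
  f x @[x --> F] --> ((a +i* b)%C : K).
Proof.
move=> /cvgrPdist_lt fa /cvgrPdist_lt fb; apply/cvgCP => e e0.
have e20 : 0 < e / 2 by rewrite divr_gt0.
near=> x.
apply: le_lt_trans (cabs_ReIm _) _; rewrite [ltRHS]splitr; apply: ltrD.
  rewrite (_ : complex.Re _ = a - complex.Re (f x)); last by case: (f x).
  by near: x; exact: fa.
rewrite (_ : complex.Im _ = b - complex.Im (f x)); last by case: (f x).
by near: x; exact: fb.
Unshelve. all: by end_near.
Qed.

Lemma cabs_Im z : `|complex.Im z| <= cabs z.
Proof.
have := cabs_Re (z * 'i%C); rewrite ReiNIm normrN cabsM.
rewrite (_ : cabs 'i%C = 1) ?mulr1 //.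
by apply: toC_inj; rewrite toC_cabs normc_def /= expr0n /= add0r expr1n sqrtr1.
Qed.

Lemma Re_sum (I : Type) (r : seq I) (P : pred I) (f : I -> K) :
  complex.Re (\sum_(i <- r | P i) f i) = \sum_(i <- r | P i) complex.Re (f i).
Proof. by apply: (big_morph (@complex.Re R)) => // -[? ?] [? ?]. Qed.
Lemma Im_sum (I : Type) (r : seq I) (P : pred I) (f : I -> K) :
  complex.Im (\sum_(i <- r | P i) f i) = \sum_(i <- r | P i) complex.Im (f i).
Proof. by apply: (big_morph (@complex.Im R)) => // -[? ?] [? ?]. Qed.

(** Completeness of the complex numbers enters only through this lemma, which is
    deduced from the real and imaginary parts. *)
Lemma series_dominated (f : nat -> K) (b : nat -> R) : cvgn (series b) ->
  (forall n, cabs (f n) <= b n) -> exists L : K, series f @ \oo --> L.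
Proof.
move=> cb fb.
have b0 n : 0 <= b n by apply: le_trans (fb n); exact: cabs_ge0.
have cR (g : nat -> R) : (forall n, `|g n| <= b n) -> cvgn (series g).
  by move=> gb; apply: normed_cvg; apply: series_le_cvg cb => // n; exact: normr_ge0.
have cRe := cR (fun n => complex.Re (f n)) (fun n => le_trans (cabs_Re _) (fb n)).
have cIm := cR (fun n => complex.Im (f n)) (fun n => le_trans (cabs_Im _) (fb n)).
eexists; apply: cvg_complex.
  rewrite (_ : (fun n => _) = series (fun n => complex.Re (f n))); first exact: cRe.
  by apply/funext => n; rewrite /series /= Re_sum.
rewrite (_ : (fun n => _) = series (fun n => complex.Im (f n))); first exact: cIm.
by apply/funext => n; rewrite /series /= Im_sum.
Qed.

Lemma cvgC_le {T : Type} {F : set_system T} {FF : ProperFilter F} (f : T -> K) l (b : R) :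
  f x @[x --> F] --> l -> (\forall x \near F, cabs (f x) <= b) -> cabs l <= b.
Proof.
move=> /cvgCP fl fb; apply/ler_addgt0Pr => e /fl fe.
have [x [/= h1 h2]] := @filter_ex _ F _ _ (filterI fe fb).
rewrite (_ : l = (l - f x) + f x); last by rewrite subrK.
by apply: le_trans (cabsD _ _) _; rewrite addrC lerD // ltW.
Qed.

Lemma series_tail (f : nat -> K) (b : nat -> R) L n : cvgn (series b) ->
  (forall n, cabs (f n) <= b n) -> series f @ \oo --> L ->
  cabs (L - series f n) <= limn (series b) - series b n.
Proof.
move=> cb fb cf.
have b0 k : 0 <= b k by apply: le_trans (fb k); exact: cabs_ge0.
have cg : (fun m => series f m - series f n) @ \oo --> L - series f n.
  exact: (cvgB cf (cvg_cst (series f n))).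
apply: (cvgC_le cg); near=> m.
have nm : (n <= m)%N by near: m; exact: nbhs_infty_ge.
rewrite (sub_series_geq _ nm); apply: le_trans (cabs_sum _ _ _) _.
apply: (@le_trans _ _ (series b m - series b n)).
  by rewrite sub_series_geq //; apply: ler_sum.
rewrite lerD2r; apply: nondecreasing_cvgn_le => // p q pq.
by rewrite -subr_ge0 sub_series_geq // sumr_ge0.
Unshelve. all: by end_near.
Qed.

(** Tannery's theorem, that is, dominated convergence for series, along an
    arbitrary filter. *)
Lemma tannery {T : Type} {F : set_system T} {FF : ProperFilter F}
    (p : T -> nat -> K) (P : T -> K) (f : nat -> K) (b : nat -> R) :
  cvgn (series b) ->
  (forall n, p x n @[x --> F] --> f n) ->
  (\forall x \near F, (forall n, cabs (p x n) <= b n) /\ series (p x) @ \oo --> P x) ->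
  exists2 L : K, series f @ \oo --> L & P x @[x --> F] --> L.
Proof.
move=> cb pf pb.
have fb n : cabs (f n) <= b n.
  by apply: (cvgC_le (pf n)); apply: filterS pb => x [].
have [L fL] := series_dominated cb fb.
exists L => //; apply/cvgCP => e e0.
have e30 : 0 < e / 3 by rewrite divr_gt0.
have /cvgrPdist_lt/(_ _ e30)[N _ HN] := cb.
have tail : limn (series b) - series b N < e / 3.
  by apply: le_lt_trans (HN N (leqnn N)); exact: ler_norm.
have cN : series (p x) N @[x --> F] --> series f N.
  elim: N {HN tail} => [|N IH].
    rewrite (_ : (fun x => series (p x) 0%N) = fun=> series f 0%N); first exact: cvg_cst.
    by apply/funext => x; rewrite /series /= !big_geq.
  rewrite (_ : (fun x => series (p x) N.+1) = fun x => series (p x) N + p x N).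
    by rewrite seriesSr; exact: cvgD IH (pf N).
  by apply/funext => x; rewrite seriesSr.
have /cvgCP/(_ _ e30) cN' := cN.
near=> x.
have [pbx px] : (forall n, cabs (p x n) <= b n) /\ series (p x) @ \oo --> P x by near: x.
rewrite (_ : L - P x = (L - series f N) + (series f N - series (p x) N) - (P x - series (p x) N)); last by ring.
apply: le_lt_trans (cabsB _ _) _.
apply: (@le_lt_trans _ _ (cabs (L - series f N) + cabs (series f N - series (p x) N) + cabs (P x - series (p x) N))).
  by rewrite lerD2r; exact: cabsD.
have h1 := series_tail N cb fb fL.
have h2 := series_tail N cb pbx px.
have h3 : cabs (series f N - series (p x) N) < e / 3 by near: x.
lra.
Unshelve. all: by end_near.
Qed.

End ComplexBasics.

(** * Power series *)

Section PowerSeries.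
Context {R : realType}.
Local Notation K := (Cfield R).
Implicit Types (F G : K -> K) (a b : nat -> K) (c z w : K) (r : R).

(** In the disc of centre [c] and radius [r], [F] is the sum of the power series
    with coefficients [a]. *)
Definition has_ps F a c r :=
  forall z, cabs (z - c) < r -> series (fun n => a n * (z - c) ^+ n) @ \oo --> F z.

Lemma cvgC_unique {T : Type} {F : set_system T} {FF : ProperFilter F} (f : T -> K) (l l' : K) :
  f x @[x --> F] --> l -> f x @[x --> F] --> l' -> l = l'.
Proof. by move=> h1 h2; apply: (cvg_unique _ h1 h2); exact: norm_hausdorff. Qed.

Lemma geometric_cvg (C q : R) : 0 <= q < 1 -> cvgn (series (geometric C q)).
Proof.
by move=> /andP[q0 q1]; apply: is_cvg_geometric_series; rewrite ger0_norm.
Qed.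

Lemma series_coef_bound a w (L : K) : series (fun n => a n * w ^+ n) @ \oo --> L ->
  exists2 C : R, 0 <= C & forall n, cabs (a n) * cabs w ^+ n <= C.
Proof.
move=> aw; have cv : cvgn (series (fun n => a n * w ^+ n)) by apply/cvg_ex; exists L.
have /cvgCP/(_ 1 ltr01)[N _ HN] := cvg_series_cvg_0 cv.
exists (1 + \sum_(i < N) cabs (a i) * cabs w ^+ i).
  by rewrite addr_ge0 // sumr_ge0 // => i _; rewrite mulr_ge0 ?exprn_ge0 ?cabs_ge0.
move=> n; have [Nn|nN] := leqP N n.
  have := HN n Nn; rewrite /= sub0r cabsN cabsM cabsX => /ltW h.
  apply: le_trans h _; rewrite lerDl sumr_ge0 // => i _.
  by rewrite mulr_ge0 ?exprn_ge0 ?cabs_ge0.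
rewrite (bigD1 (Ordinal nN)) //= addrCA lerDl addr_ge0 // sumr_ge0 // => i _.
by rewrite mulr_ge0 ?exprn_ge0 ?cabs_ge0.
Qed.

Lemma has_ps_bound F a c r r1 : has_ps F a c r -> 0 <= r1 < r ->
  exists2 C : R, 0 <= C & forall n, cabs (a n) * r1 ^+ n <= C.
Proof.
move=> Fps /andP[r10 r1r]; have := Fps (c + toC r1).
have -> : c + toC r1 - c = toC r1 by ring.
rewrite cabs_toC ger0_norm // => /(_ r1r)/series_coef_bound.
by rewrite cabs_toC ger0_norm.
Qed.

Lemma has_ps_weak F a c r r' : r' <= r -> has_ps F a c r -> has_ps F a c r'.
Proof. by move=> r'r H z zr; apply: H; apply: lt_le_trans r'r. Qed.

Lemma has_ps_ext F G a c r : (forall z, cabs (z - c) < r -> F z = G z) ->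
  has_ps F a c r -> has_ps G a c r.
Proof. by move=> FG H z zr; rewrite -FG //; exact: H. Qed.

Lemma has_ps_at F a c r : 0 < r -> has_ps F a c r -> F c = a 0%N.
Proof.
move=> r0 /(_ c); rewrite subrr cabs0 => /(_ r0) H.
apply: (cvgC_unique H).
apply: cvg_near_cst; near=> n.
have n0 : (0 < n)%N by near: n; exact: nbhs_infty_gt.
rewrite /series /= -(prednK n0) big_nat_recl // expr0 mulr1 big1 ?addr0 // => i _.
by rewrite expr0n mulr0.
Unshelve. all: by end_near.
Qed.

Lemma sum_exp_bound (n : nat) (x y : R) z w : cabs z <= x -> cabs w <= x -> x < y ->
  cabs (\sum_(i < n) z ^+ (n.-1 - i) * w ^+ i) <= y ^+ n / (y - x).
Proof.
move=> zx wx xy; have x0 : 0 <= x by apply: le_trans zx; exact: cabs_ge0.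
have y0 : 0 <= y by exact: le_trans x0 (ltW xy).
rewrite ler_pdivlMr ?subr_gt0 //.
apply: (@le_trans _ _ (y ^+ n - x ^+ n)); last by rewrite lerBlDr lerDl exprn_ge0.
rewrite subrXX mulrC; apply: ler_wpM2l; first by rewrite subr_ge0 ltW.
apply: le_trans (cabs_sum _ _ _) _; apply: ler_sum => i _.
rewrite cabsM !cabsX; apply: ler_pM; rewrite ?exprn_ge0 ?cabs_ge0 //.
  by rewrite lerXn2r ?nnegrE ?cabs_ge0 // (le_trans zx) // ltW.
by rewrite lerXn2r ?nnegrE ?cabs_ge0.
Qed.

Lemma cvgC_X {T : Type} {F : set_system T} {FF : Filter F} (f : T -> K) (l : K) n :
  f x @[x --> F] --> l -> f x ^+ n @[x --> F] --> l ^+ n.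
Proof.
move=> fl; elim: n => [|n IH].
  by under eq_fun do rewrite expr0; rewrite expr0; exact: cvg_cst.
by under eq_fun do rewrite exprS; rewrite exprS; exact: cvgM fl IH.
Qed.

Lemma cvgC_sum {T : Type} {F : set_system T} {FF : Filter F} n
    (f : 'I_n -> T -> K) (l : 'I_n -> K) :
  (forall i, f i x @[x --> F] --> l i) ->
  \sum_(i < n) f i x @[x --> F] --> \sum_(i < n) l i.
Proof.
elim: n f l => [|n IH] f l fl.
  by under eq_fun do rewrite big_ord0; rewrite big_ord0; exact: cvg_cst.
under eq_fun do rewrite big_ord_recl; rewrite big_ord_recl.
exact: cvgD (fl ord0) (IH _ _ (fun i => fl (lift ord0 i))).
Qed.

Lemma series_shift (f : nat -> K) (L : K) : f 0%N = 0 -> series f @ \oo --> L ->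
  series (fun n => f n.+1) @ \oo --> L.
Proof.
move=> f0 fL.
rewrite (_ : series _ = fun n => series f n.+1); last first.
  by apply/funext => n; rewrite /series /= big_nat_recl // f0 add0r.
by rewrite cvg_shiftS.
Qed.

(** Termwise differentiation: the difference quotient at [z] is the sum over [n]
    of [a n] times a homogeneous polynomial of degree [n - 1] in two points of
    a smaller disc, and Tannery's theorem gives its limit. *)
Lemma has_ps_derive F a c r : has_ps F a c r ->
  has_ps (derive1 F) (fun n => n.+1%:R * a n.+1) c r.
Proof.
move=> Fps z; set w := z - c => wr.
(* Three radii between cabs w and r: w and w + h stay within r1, the factor n of
   the derivative is absorbed between r1 and r2, and a n * r3 ^+ n is bounded. *)
pose dr := (r - cabs w) / 4.
have dr0 : 0 < dr by rewrite divr_gt0 // subr_gt0.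
pose r1 := cabs w + dr; pose r2 := r1 + dr; pose r3 := r2 + dr.
have r10 : 0 < r1 by rewrite ltr_wpDl // cabs_ge0.
have r20 : 0 < r2 by rewrite addr_gt0.
have r30 : 0 < r3 by rewrite addr_gt0.
have r3r : r3 < r by rewrite /r3 /r2 /r1 /dr; move: dr0; rewrite /dr; lra.
have r12 : r1 < r2 by rewrite ltrDl.
have r23 : r2 < r3 by rewrite ltrDl.
have r3b : 0 <= r3 < r by rewrite (ltW r30) r3r.
have [C C0 HC] := has_ps_bound Fps r3b.
pose p (h : K) n := a n * \sum_(i < n) (w + h) ^+ (n.-1 - i) * w ^+ i.
pose f n := a n * (n%:R * w ^+ n.-1).
pose b := geometric (C / (r2 - r1)) (r2 / r3).
have cb : cvgn (series b).
  by apply: geometric_cvg; rewrite divr_ge0 ?(ltW r20) ?(ltW r30) //= ltr_pdivrMr // mul1r.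
have pf n : p h n @[h --> 0^'] --> f n.
  have wh : w + h @[h --> (0 : K)^'] --> w.
    rewrite -[X in _ --> X]addr0; apply: cvgD; first exact: cvg_cst.
    exact: nbhs_dnbhs.
  apply: cvgM; first exact: cvg_cst.
  rewrite mulr_natl -[X in _ *+ X]card_ord -sumr_const.
  apply: cvgC_sum => i.
  rewrite (_ : w ^+ n.-1 = w ^+ (n.-1 - i) * w ^+ i); last first.
    by rewrite -exprD subnK // -ltnS prednK // (leq_ltn_trans _ (ltn_ord i)).
  by apply: cvgM; [exact: cvgC_X | exact: cvg_cst].
have pP : \forall h \near (0 : K)^', (forall n, cabs (p h n) <= b n) /\
    series (p h) @ \oo --> h^-1 *: (F (h + z) - F z).
  have : \forall h \near (0 : K)^', h != 0 /\ cabs h < dr.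
    have N1 : \forall h \near (0 : K)^', h != 0 by exact: nbhs_dnbhs_neq.
    have N2 : \forall h \near (0 : K)^', cabs h < dr.
      by apply: nbhs_dnbhs; apply/nearCP; exists dr => // h; rewrite subr0.
    by apply: filterS2 N1 N2 => h.
  apply: filterS => h [h0 hdr]; split.
    move=> n; rewrite /p cabsM.
    have wh1 : cabs (w + h) <= r1 by apply: le_trans (cabsD _ _) _; rewrite lerD2l ltW.
    have w1 : cabs w <= r1 by rewrite lerDl ltW.
    apply: (@le_trans _ _ (cabs (a n) * (r2 ^+ n / (r2 - r1)))).
      by apply: ler_wpM2l; [exact: cabs_ge0 | exact: sum_exp_bound].
    rewrite /b /= expr_div_n.
    rewrite (_ : C / _ * _ = C * (r2 ^+ n / (r3 ^+ n * (r2 - r1)))); last first.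
      field; rewrite gt_eqF ?subr_gt0 //= ; rewrite expf_neq0 //; exact: lt0r_neq0.
    rewrite (_ : cabs (a n) * _ = (cabs (a n) * r3 ^+ n) * (r2 ^+ n / (r3 ^+ n * (r2 - r1)))); last first.
      field; rewrite gt_eqF ?subr_gt0 //= ; rewrite expf_neq0 //; exact: lt0r_neq0.
    apply: ler_wpM2r (HC n); rewrite divr_ge0 ?exprn_ge0 ?(ltW r20) //.
    by rewrite mulr_ge0 ?exprn_ge0 ?(ltW r30) // subr_ge0 ltW.
  have Fz := Fps z wr; have Fh : series (fun n => a n * (w + h) ^+ n) @ \oo --> F (h + z).
    have -> : w + h = h + z - c by rewrite /w; ring.
    apply: Fps; have -> : h + z - c = w + h by rewrite /w; ring.
    apply: le_lt_trans (cabsD _ _) _; rewrite /dr in hdr; lra.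
  rewrite (_ : series (p h) = fun n => h^-1 * (series (fun n => a n * (w + h) ^+ n) n -
     series (fun n => a n * w ^+ n) n)); last first.
    apply/funext => n; rewrite /series /= -sumrB big_distrr /=; apply: eq_bigr => i _.
    rewrite /p -mulrBr subrXX (_ : w + h - w = h); last by ring.
    by rewrite [RHS]mulrCA mulKf.
  by apply: cvgM; [exact: cvg_cst | exact: cvgB Fh Fz].
have [L fL PL] := tannery cb pf pP.
have -> : derive1 F z = L.
  by apply: cvg_lim PL; exact: norm_hausdorff.
have f0 : f 0%N = 0 by rewrite /f mul0r mulr0.
rewrite (_ : (fun n => _) = fun n => f n.+1); first exact: series_shift.
by apply/funext => n; rewrite /f /=; ring.
Qed.

Lemma has_ps_deriven F a c r m : has_ps F a c r ->
  has_ps (derive1n m F) (fun n => ((n + m) ^_ m)%:R * a (n + m)%N) c r.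
Proof.
move=> Fps; elim: m => [|m IH].
  rewrite derive1n0; move: Fps; congr (has_ps _ _ _ _).
  by apply/funext => n; rewrite addn0 ffactn0 mul1r.
rewrite derive1nS; have := has_ps_derive IH; congr (has_ps _ _ _ _).
apply/funext => n; rewrite addnS addSn mulrA -natrM; congr (_%:R * _).
by rewrite ffactnSr mulnC -addSn addnK.
Qed.

Lemma deriven_coef F a c r m : 0 < r -> has_ps F a c r ->
  derive1n m F c = m`!%:R * a m.
Proof.
by move=> r0 Fps; rewrite (has_ps_at r0 (has_ps_deriven (m := m) Fps)) add0n ffactnn.
Qed.

(** The partial sums of the Cauchy product are the sums over [i < m] of
    [a i * series b (m - i)], to which Tannery's theorem applies. *)
Lemma cauchy_product (a b : nat -> K) (ba bb : nat -> R) (A B : K) :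
  cvgn (series ba) -> cvgn (series bb) ->
  (forall n, cabs (a n) <= ba n) -> (forall n, cabs (b n) <= bb n) ->
  series a @ \oo --> A -> series b @ \oo --> B ->
  series (fun n => \sum_(i < n.+1) a i * b (n - i)%N) @ \oo --> A * B.
Proof.
move=> cba cbb aba bbb aA bB.
set conv := (fun n : nat => _).
pose p (m i : nat) : K := if (i < m)%N then a i * series b (m - i)%N else 0.
pose M := limn (series bb).
have bM k : cabs (series b k) <= M.
  apply: le_trans (cabs_sum _ _ _) _.
  apply: (@le_trans _ _ (series bb k)); first exact: ler_sum.
  apply: nondecreasing_cvgn_le => // i j ij.
  rewrite -subr_ge0 sub_series_geq // sumr_ge0 // => n _.
  by apply: le_trans (bbb n); exact: cabs_ge0.
have M0 : 0 <= M by apply: le_trans (bM 0%N); exact: cabs_ge0.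
have convE m : series conv m = \sum_(0 <= i < m) a i * series b (m - i)%N.
  elim: m => [|m IH]; first by rewrite /series /= !big_geq.
  rewrite seriesSr IH /conv big_nat_recr //= subSnn.
  rewrite [in LHS]big_ord_recr /= subnn -(big_mkord xpredT (fun i => a i * b (m - i)%N)).
  rewrite addrA -big_split /=; congr (_ + _ * _); last first.
    by rewrite /series /= big_nat1.
  apply: eq_big_nat => i /andP[_ im]; rewrite -mulrDr; congr (_ * _).
  by rewrite subSn ?(ltnW im) // seriesSr.
have cB : cvgn (series (fun n => ba n * M)).
  rewrite (_ : series _ = fun n => series ba n * M); last first.
    by apply/funext => n; rewrite /series /= big_distrl.
  by apply/cvg_ex; exists (limn (series ba) * M); exact: cvgM cba (cvg_cst M).
have pf i : p m i @[m --> \oo] --> a i * B.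
  have h : (fun m => a i * series b (m - i)%N) @ \oo --> a i * B.
    by apply: cvgM; [exact: cvg_cst | exact: (cvg_comp _ _ (cvg_subnr i) bB)].
  apply: cvg_trans h; apply: near_eq_cvg; near=> m.
  have im : (i < m)%N by near: m; exact: nbhs_infty_gt.
  by rewrite /p im.
have pP : \forall m \near \oo, (forall n, cabs (p m n) <= ba n * M) /\
    series (p m) @ \oo --> series conv m.
  near=> m; split.
    move=> n; rewrite /p; case: ifP => _; last by rewrite cabs0 mulr_ge0 // (le_trans (cabs_ge0 _) (aba n)).
    by rewrite cabsM; apply: ler_pM => //; exact: cabs_ge0.
  apply: cvg_near_cst; near=> k.
  have mk : (m <= k)%N by near: k; exact: nbhs_infty_ge.
  have tail0 : \sum_(m <= i < k) p m i = 0.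
    by rewrite big_nat big1 // => i /andP[mi _]; rewrite /p ltnNge mi.
  rewrite convE /series /= (big_cat_nat (leq0n m) mk) /= tail0 addr0.
  by apply: eq_big_nat => i /andP[_ im]; rewrite /p im.
have [L fL convL] := tannery cB pf pP.
have fAB : series (fun i => a i * B) @ \oo --> A * B.
  have -> : series (fun i => a i * B) = fun n => series a n * B.
    by apply/funext => n; rewrite /series /= big_distrl.
  exact: cvgM aA (cvg_cst B).
rewrite -(cvgC_unique fL fAB); exact: convL.
Unshelve. all: by end_near.
Qed.

End PowerSeries.

(** * Operations on power series, the complex exponential *)

Section PowerSeriesAlgebra.
Context {R : realType}.
Local Notation K := (Cfield R).
Implicit Types (F G : K -> K) (a b : nat -> K) (c z w : K) (r : R).

Lemma has_ps_dom F a c r w : has_ps F a c r -> cabs w < r ->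
  exists2 b : nat -> R, cvgn (series b) & forall n, cabs (a n * w ^+ n) <= b n.
Proof.
move=> Fps wr; pose r1 := (cabs w + r) / 2.
have w0 := cabs_ge0 w.
have r1w : cabs w < r1 by rewrite /r1; lra.
have r10 : 0 < r1 by exact: le_lt_trans r1w.
have r1b : 0 <= r1 < r by rewrite (ltW r10) /= /r1; lra.
have [C C0 HC] := has_ps_bound Fps r1b.
exists (geometric C (cabs w / r1)).
  by apply: geometric_cvg; rewrite divr_ge0 ?(ltW r10) //= ltr_pdivrMr // mul1r.
move=> n; rewrite /= cabsM cabsX expr_div_n mulrA ler_pdivlMr ?exprn_gt0 //.
by rewrite mulrAC; apply: ler_wpM2r (HC n); rewrite exprn_ge0.
Qed.

Lemma has_psM F G a b c r : has_ps F a c r -> has_ps G b c r ->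
  has_ps (fun z => F z * G z) (fun n => \sum_(i < n.+1) a i * b (n - i)%N) c r.
Proof.
move=> Fps Gps z zr.
have [ba cba Hba] := has_ps_dom Fps zr; have [bb cbb Hbb] := has_ps_dom Gps zr.
have := cauchy_product cba cbb Hba Hbb (Fps _ zr) (Gps _ zr).
rewrite (_ : (fun n => \sum_(i < n.+1) a i * (z - c) ^+ i * _) =
   (fun n => (\sum_(i < n.+1) a i * b (n - i)%N) * (z - c) ^+ n)) => [H|]; first exact: H.
apply/funext => n; rewrite big_distrl /=; apply: eq_bigr => i _.
by rewrite mulrACA -exprD subnKC // -ltnS.
Qed.

Lemma has_ps_fin a N c r : (forall n, (N <= n)%N -> a n = 0) ->
  has_ps (fun z => \sum_(n < N) a n * (z - c) ^+ n) a c r.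
Proof.
move=> aN z _; apply: cvg_near_cst; near=> k.
have Nk : (N <= k)%N by near: k; exact: nbhs_infty_ge.
have tail0 : \sum_(N <= i < k) a i * (z - c) ^+ i = 0.
  by rewrite big_nat big1 // => i /andP[Ni _]; rewrite aN // mul0r.
by rewrite /series /= (big_cat_nat (leq0n N) Nk) /= tail0 addr0 big_mkord.
Unshelve. all: by end_near.
Qed.

Lemma has_psZ (k : K) F a c r : has_ps F a c r ->
  has_ps (fun z => k * F z) (fun n => k * a n) c r.
Proof.
move=> Fps z zr; rewrite (_ : series _ = fun n => k * series (fun n => a n * (z - c) ^+ n) n).
  exact: cvgM (cvg_cst k) (Fps z zr).
apply/funext => n; rewrite /series /= big_distrr /=; apply: eq_bigr => i _.
by rewrite mulrA.
Qed.

Lemma has_psD F G a b c r : has_ps F a c r -> has_ps G b c r ->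
  has_ps (fun z => F z + G z) (fun n => a n + b n) c r.
Proof.
move=> Fps Gps z zr.
rewrite (_ : series _ = fun n => series (fun n => a n * (z - c) ^+ n) n + series (fun n => b n * (z - c) ^+ n) n).
  exact: cvgD (Fps z zr) (Gps z zr).
apply/funext => n; rewrite /series /= -big_split /=; apply: eq_bigr => i _.
by rewrite mulrDl.
Qed.

Lemma has_ps_prod (I : eqType) (s : seq I) (F : I -> K -> K) c :
  (forall i, exists a r, 0 < r /\ has_ps (F i) a c r) ->
  exists a r, 0 < r /\ has_ps (fun z => \prod_(i <- s) F i z) a c r.
Proof.
move=> HF; elim: s => [|i s [b [r [r0 IH]]]].
  exists (fun n => if n == 0%N then 1 else 0), 1; split => //.
  have fin n : (1 <= n)%N -> (if n == 0%N then 1 else 0 : K) = 0 by case: n.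
  apply: has_ps_ext (has_ps_fin (r := 1) fin) => z _.
  by rewrite big_ord1 expr0 mulr1 big_nil.
have [a [r' [r'0 Fps]]] := HF i.
exists (fun n => \sum_(i < n.+1) a i * b (n - i)%N), (Num.min r r').
split; first by rewrite lt_min r0 r'0.
have h1 : Num.min r r' <= r' by rewrite ge_min lexx orbT.
have h2 : Num.min r r' <= r by rewrite ge_min lexx.
apply: has_ps_ext (has_psM (has_ps_weak h1 Fps) (has_ps_weak h2 IH)) => z _.
by rewrite big_cons.
Qed.

(** Taylor's formula along the real direction, to the right of the centre. *)
Lemma has_ps_remainder F a c r m : 0 < r -> has_ps F a c r ->
  exists C : R, forall t : R, 0 < t <= r / 4 ->
    cabs (F (c + toC t) - \sum_(k < m) a k * toC t ^+ k) <= C * t ^+ m.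
Proof.
move=> r0 Fps; pose r1 := r / 2.
have r10 : 0 < r1 by rewrite divr_gt0.
have r1b : 0 <= r1 < r by rewrite (ltW r10) /= /r1; lra.
have [C C0 HC] := has_ps_bound Fps r1b.
exists (2 * C / r1 ^+ m) => t /andP[t0 tr].
pose q := t / r1.
have q0 : 0 <= q by rewrite divr_ge0 // ltW.
have q2 : q <= 2^-1 by rewrite ler_pdivrMr //; rewrite /r1; lra.
have cq : cvgn (series (geometric C q)) by apply: geometric_cvg; rewrite q0 /=; lra.
have bq n : cabs (a n * toC t ^+ n) <= geometric C q n.
  rewrite cabsM cabsX cabs_toC ger0_norm ?(ltW t0) //= expr_div_n mulrA.
  rewrite ler_pdivlMr ?exprn_gt0 // mulrAC; apply: ler_wpM2r (HC n).
  by rewrite exprn_ge0 // ltW.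
have Ft : series (fun n => a n * toC t ^+ n) @ \oo --> F (c + toC t).
  have := Fps (c + toC t); rewrite (_ : c + toC t - c = toC t); last by ring.
  by apply; rewrite cabs_toC ger0_norm ?(ltW t0) //; lra.
have := series_tail m cq bq Ft.
have q1 : q < 1 by lra.
have q1' : `|q| < 1 by rewrite ger0_norm.
rewrite (cvg_lim _ (@cvg_geometric_series _ C q q1')); last exact: Rhausdorff.
rewrite geometric_seriesE ?lt_eqF //= [X in X <= _ -> _](_ : _ = cabs (F (c + toC t) - \sum_(k < m) a k * toC t ^+ k)); last first.
  by rewrite /series /= big_mkord.
move/le_trans; apply.
rewrite (_ : C / (1 - q) - _ = C * q ^+ m / (1 - q)); last first.
  by field; rewrite subr_eq0 gt_eqF.
rewrite ler_pdivrMr; last by lra.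
rewrite (_ : 2 * C / r1 ^+ m * t ^+ m * (1 - q) = C * q ^+ m * (2 * (1 - q))); last first.
  have -> : q ^+ m = t ^+ m / r1 ^+ m by rewrite expr_div_n.
  by ring.
rewrite -[leLHS]mulr1; apply: ler_wpM2l; last by lra.
by rewrite mulr_ge0 // exprn_ge0.
Qed.

(** The complex exponential. *)
Definition cexp (z : K) : K :=
  ((expR (complex.Re z) * cos (complex.Im z)) +i*
   (expR (complex.Re z) * sin (complex.Im z)))%C.

Lemma toC_series (f : nat -> R) : series (fun n => toC (f n)) = fun n => toC (series f n).
Proof. by apply/funext => n; rewrite /series /= rmorph_sum. Qed.

Lemma cvg_exp_real (x : R) : series (fun n => toC x ^+ n / n`!%:R) @ \oo --> toC (expR x).
Proof.
rewrite (_ : (fun n => _) = fun n => toC (exp_coeff x n)); last first.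
  by apply/funext => n; rewrite /exp_coeff /= rmorphM fmorphV rmorphXn rmorph_nat.
rewrite toC_series; apply: cvg_toC; exact: is_cvg_series_exp_coeff.
Qed.

Lemma cvg_exp_imag (y : R) :
  series (fun n => ((0 +i* y)%C : K) ^+ n / n`!%:R) @ \oo --> ((cos y +i* sin y)%C : K).
Proof.
have coefE n : ((0 +i* y)%C : K) ^+ n / n`!%:R = ((cos_coeff y n) +i* (sin_coeff y n))%C.
  have -> : ((0 +i* y)%C : K) = 'i%C * toC y by rewrite /toC; simpc.
  rewrite exprMn.
  have iE : ('i%C : K) ^+ n = ((~~ odd n)%:R * (-1) ^+ n./2 +i* ((odd n)%:R * (-1) ^+ n.-1./2))%C.
    rewrite -{1}(odd_double_half n) exprD -mul2n exprM sqr_i.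
    have m1 k : (-1 : K) ^+ k = toC ((-1) ^+ k) by rewrite rmorphXn rmorphN rmorph1.
    rewrite m1; case: (boolP (odd n)) => on /=.
      have -> : (n.-1)./2 = n./2 by case: n on => // n /=; rewrite uphalf_half => /negbTE ->.
      by rewrite expr1 /toC; simpc.
    by rewrite expr0 /toC; simpc.
  rewrite iE -rmorphXn -(rmorph_nat (@toC R)) -fmorphV -mulrA -rmorphM /toC /cos_coeff /sin_coeff /=.
  by simpc; rewrite -exprnP !mulrA.
rewrite (_ : (fun n => _) = fun n => ((cos_coeff y n) +i* (sin_coeff y n))%C : K); last first.
  by apply/funext.
apply: cvg_complex.
  rewrite (_ : (fun n => _) = series (cos_coeff y)).
    by rewrite unlock; exact: is_cvg_series_cos_coeff.
  by apply/funext => n; rewrite /series /= Re_sum.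
rewrite (_ : (fun n => _) = series (sin_coeff y)).
  by rewrite unlock; exact: is_cvg_series_sin_coeff.
by apply/funext => n; rewrite /series /= Im_sum.
Qed.

(** The Cauchy product of the series of the exponentials of the real part and of
    [i] times the imaginary part. *)
Lemma cvg_cexp z : series (fun n => z ^+ n / n`!%:R) @ \oo --> cexp z.
Proof.
case: z => x y.
have bnd (w : K) (t : R) : cabs w = t -> forall n, cabs (w ^+ n / n`!%:R) <= exp_coeff t n.
  move=> wt n; rewrite cabsM cabsX cabsV wt /exp_coeff /=.
  by rewrite -(rmorph_nat (@toC R)) cabs_toC ger0_norm.
have := cauchy_product (is_cvg_series_exp_coeff _) (is_cvg_series_exp_coeff _)
  (bnd _ _ erefl) (bnd _ _ erefl) (@cvg_exp_real x) (@cvg_exp_imag y).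
rewrite (_ : toC (expR x) * _ = cexp (x +i* y)%C); last first.
  by rewrite /cexp /toC /=; simpc.
rewrite (_ : (fun n => \sum_(i < n.+1) _) = fun n => ((x +i* y)%C : K) ^+ n / n`!%:R) => [H|].
  exact: H.
apply/funext => n.
have -> : ((x +i* y)%C : K) = (0 +i* y)%C + toC x by rewrite /toC; simpc.
rewrite exprDn big_distrl /=; apply: eq_bigr => i _.
have ni : (i <= n)%N by rewrite -ltnS.
have bf := bin_fact ni.
have fn0 k : (k`!%:R : K) != 0 by rewrite -(rmorph_nat (@toC R)) fmorph_eq0 pnatr_eq0 -lt0n fact_gt0.
rewrite -[_ *+ 'C(n, i)]mulr_natr -bf !natrM; field.
rewrite !fn0 /=; have := fn0 n; rewrite -bf !natrM !mulf_eq0 !negb_or => /andP[-> _]//.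
Qed.

Lemma cpowE (x : R) z : cpow x z = cexp (z * toC (ln x)).
Proof. by case: z => a b; rewrite /cpow /cexp /toC /=; simpc. Qed.

Lemma cexp_shift (x : R) w : cexp (toC x + w) = toC (expR x) * cexp w.
Proof. by case: w => a b; rewrite /cexp /toC /= expRD; simpc; rewrite !mulrA. Qed.

Lemma cabs_cexp z : cabs (cexp z) = expR (complex.Re z).
Proof.
case: z => a b; apply: toC_inj; rewrite toC_cabs normc_def /=.
rewrite !exprMn -mulrDr cos2Dsin2 mulr1 sqrtr_sqr ger0_norm ?expR_ge0 //.
Qed.

Lemma has_ps_cpow (x alpha r : R) : has_ps (cpow x)
  (fun n => toC (expR (alpha * ln x) * (ln x ^+ n / n`!%:R))) (toC alpha) r.
Proof.
move=> z _; set w := z - toC alpha.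
rewrite (_ : series _ = fun n => toC (expR (alpha * ln x)) *
   series (fun n => (w * toC (ln x)) ^+ n / n`!%:R) n); last first.
  apply/funext => n; rewrite /series /= big_distrr /=; apply: eq_bigr => i _.
  rewrite !rmorphM fmorphV rmorphXn rmorph_nat exprMn.
  by ring.
rewrite (_ : cpow x z = toC (expR (alpha * ln x)) * cexp (w * toC (ln x))).
  exact: cvgM (cvg_cst _) (@cvg_cexp _).
rewrite cpowE -cexp_shift; congr cexp; rewrite rmorphM /w /=; ring.
Qed.

Lemma has_ps_inv (alpha : R) : 0 < alpha -> has_ps (fun z => z^-1)
  (fun n => toC ((-1) ^+ n / alpha ^+ n.+1)) (toC alpha) alpha.
Proof.
move=> a0 z; set w := z - toC alpha => wa.
have A0 : toC alpha != 0 by rewrite -cabs_gt0 cabs_toC gtr0_norm.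
pose q := - (w / toC alpha).
have q1 : cabs q < 1.
  by rewrite cabsN cabsM cabsV cabs_toC (gtr0_norm a0) ltr_pdivrMr // mul1r.
have qn1 : q != 1 by apply: contraTneq q1 => ->; rewrite cabs1 ltxx.
have sE : series (fun n => toC ((-1) ^+ n / alpha ^+ n.+1) * w ^+ n) =
    series (geometric (toC alpha)^-1 q).
  congr series; apply/funext => n /=; rewrite rmorphM fmorphV !rmorphXn rmorphN rmorph1.
  have -> : q = -1 * (w / toC alpha) by rewrite mulN1r.
  rewrite !exprMn exprVn exprS invfM.
  by ring.
rewrite sE geometric_seriesE //.
have -> : z^-1 = (toC alpha)^-1 * (1 - 0) / (1 - q).
  have -> : z = toC alpha * (1 - q) by rewrite /q /w; field.
  by rewrite subr0 mulr1 invfM.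
apply: cvgM; last exact: cvg_cst.
apply: cvgM; first exact: cvg_cst.
apply: cvgB; first exact: cvg_cst.
apply/cvgCP => e e0.
have : (fun n => cabs q ^+ n) @ \oo --> (0 : R).
  by apply: cvg_expr; rewrite ger0_norm ?cabs_ge0.
move=> /cvgrPdist_lt/(_ _ e0); apply: filterS => n.
by rewrite !sub0r normrN (cabsN (q ^+ n)) cabsX ger0_norm ?exprn_ge0 ?cabs_ge0.
Qed.

End PowerSeriesAlgebra.

(** * Continuation of the Dirichlet series of one sequence *)

Section SingleSequence.
Context {R : realType}.
Local Notation K := (Cfield R).

Lemma toC_psum {T : choiceType} (h : T -> R) (c : T -> R) u :
  toC (psum h c u) = psum h (fun t => toC (c t)) u.
Proof. by rewrite /psum rmorph_sum. Qed.

Lemma cvg_big_seq (I : Type) (s : seq I) (f : I -> nat -> K) (l : I -> K) :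
  (forall i, f i n @[n --> \oo] --> l i) ->
  \sum_(i <- s) f i n @[n --> \oo] --> \sum_(i <- s) l i.
Proof.
move=> fl; elim: s => [|i s IH].
  by under eq_fun do rewrite big_nil; rewrite big_nil; exact: cvg_cst.
under eq_fun do rewrite big_cons; rewrite big_cons.
exact: cvgD (fl i) IH.
Qed.

(** An absolutely convergent complex series may be summed in the order of
    increasing [h]. *)
Lemma series_psum_cvg (h : nat -> R) (s D : R) (f : nat -> K) : loc_fin h ->
  is_dsum h s D -> (forall k, cabs (f k) <= expR (- s * h k)) ->
  exists2 L : K, series f @ \oo --> L & psum h f m%:R @[m --> \oo] --> L.
Proof.
move=> hfin [D1 D2] fb; pose b k := expR (- s * h k).
have b0 k : 0 <= b k by exact: expR_ge0.
have ndb : {homo series b : i j / (i <= j)%N >-> i <= j}.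
  by move=> i j ij; rewrite -subr_ge0 sub_series_geq // sumr_ge0.
have inc m N : (forall k, h k <= m -> (k < N)%N) -> forall (V : nmodType) (c : nat -> V),
    psum h c m = \sum_(0 <= k < N | h k <= m) c k.
  move=> hN V c; apply: psum_seq; first exact: iota_uniq.
  by move=> k /hN kN; rewrite mem_index_iota.
have exN m : exists N0, forall k, h k <= m -> (k < N0)%N.
  have := hfin m => /finite_seqP[s0 s0E].
  exists (\max_(k <- s0) k).+1 => k hk; rewrite ltnS.
  have : k \in s0 by have : [set t | h t <= m] k by []; rewrite s0E.
  by move=> ks; exact: leq_bigmax_seq.
have seriesb N : series b N <= D.
  pose M := \sum_(k < N) `|h k|.
  apply: le_trans (D1 M).
  have [N0 HN0] := exN M.
  rewrite (inc M (maxn N N0)); last by move=> k /HN0 kN; rewrite leq_max kN orbT.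
  rewrite (big_cat_nat (leq0n N) (leq_maxl _ _)) /=.
  rewrite -[leLHS]addr0; apply: lerD; last by apply: sumr_ge0 => k _; exact: b0.
  rewrite /series /= !big_mkord [leRHS]big_mkcond /=; apply: ler_sum => k _.
  rewrite ifT // /M (bigD1 k) //=; apply: le_trans (ler_norm _) _.
  by rewrite lerDl sumr_ge0.
have cb : cvgn (series b).
  apply: nondecreasing_is_cvgn => //; exists D => _ [N _ <-]; exact: seriesb.
have [L fL] := series_dominated cb fb.
exists L => //; apply/cvgCP => e e0.
have e20 : 0 < e / 2 by rewrite divr_gt0.
have [v Dv] := D2 _ e20.
near=> m.
have vm : v <= m%:R by near: m; exact: nbhs_infty_ger.
apply: (@le_lt_trans _ _ (e / 2)); last by lra.
have cg : (fun N => series f N - psum h f m%:R) @ \oo --> L - psum h f m%:R.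
  exact: cvgB fL (cvg_cst _).
apply: (cvgC_le cg).
have [N0 HN0] := exN m%:R.
near=> N.
have N0N : (N0 <= N)%N by near: N; exact: nbhs_infty_ge.
have HN k : h k <= m%:R -> (k < N)%N by move=> /HN0 /leq_trans; apply.
have splitE (V : zmodType) (c : nat -> V) : series c N - psum h c m%:R = \sum_(0 <= k < N | ~~ (h k <= m%:R)) c k.
  by rewrite (inc _ N HN) /series /= (bigID (fun k => h k <= m%:R)) /= addrAC subrr add0r.
rewrite splitE; apply: le_trans (cabs_sum _ _ _) _.
apply: (@le_trans _ _ (series b N - psum h b m%:R)).
  by rewrite splitE; apply: ler_sum.
have := psum_exp_mono s hfin vm; have := seriesb N; rewrite -/b in Dv *; lra.
Unshelve. all: by end_near.
Qed.

(** The value at [v] is the [n]-th Taylor coefficient of [exp (- w v)] at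
    [w = 0], seen as a polynomial in [v]. *)
Definition texp (n : nat) : {poly R} := ((-1) ^+ n / n`!%:R) *: 'X^n.

Lemma texpE n (v : R) : (texp n).[v] = (- v) ^+ n / n`!%:R.
Proof. by rewrite /texp hornerZ hornerXn -[in RHS]mulN1r exprMn; ring. Qed.

Lemma texp_deriv n : (texp n.+1)^`() = - texp n.
Proof.
rewrite /texp derivZ derivXn /= -['X^n *+ _]scaler_nat scalerA -scaleNr; congr (_ *: _).
have f0 : n`!%:R != 0 :> R by rewrite pnatr_eq0 -lt0n fact_gt0.
have n0 : n.+1%:R != 0 :> R by rewrite pnatr_eq0.
rewrite factS natrM exprS; move: (n.+1%:R) (n`!%:R) n0 f0 => x y x0 y0.
by field; rewrite ?x0 ?y0.
Qed.

Lemma texp_bound n (r v : R) : 0 < r -> `|(texp n).[v]| <= expR (r * `|v|) / r ^+ n.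
Proof.
move=> r0; rewrite texpE normrM normrX normrN normfV normr_nat.
rewrite ler_pdivlMr ?exprn_gt0 // mulrAC -exprMn (mulrC `|v|).
by apply: exp_ge_pow_fact; rewrite mulr_ge0 // ltW.
Qed.

Lemma texp_deriv_bound n (r v : R) : 0 < r ->
  `|(texp n)^`().[v]| <= r / r ^+ n * expR (r * `|v|).
Proof.
move=> r0; case: n => [|n].
  rewrite /texp expr0 alg_polyC derivC horner0 normr0.
  by rewrite mulr_ge0 ?expR_ge0 // divr_ge0 ?exprn_ge0 // ltW.
rewrite texp_deriv hornerN normrN; apply: le_trans (texp_bound n v r0) _.
rewrite exprS invfM mulrA divff ?mul1r; last exact: lt0r_neq0.
by rewrite mulrC.
Qed.

Lemma cvg_texp (v : R) (w : K) :
  series (fun n => toC (texp n).[v] * w ^+ n) @ \oo --> cexp (- (toC v * w)).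
Proof.
rewrite (_ : (fun n => _) = fun n => (- (toC v * w)) ^+ n / n`!%:R); first exact: cvg_cexp.
apply/funext => n; rewrite texpE rmorphM fmorphV rmorphXn rmorphN rmorph_nat.
by rewrite -mulNr exprMn; ring.
Qed.

Lemma cvg_texpS (v : R) (w : K) : w != 0 ->
  series (fun n => toC (texp n.+1).[v] * w ^+ n) @ \oo --> (cexp (- (toC v * w)) - 1) / w.
Proof.
move=> w0.
rewrite (_ : series _ = fun n => (series (fun n => toC (texp n).[v] * w ^+ n) n.+1 - 1) / w); last first.
  apply/funext => n; rewrite /series /= big_nat_recl // texpE expr0 fact0 divr1 rmorph1 mul1r.
  rewrite addrAC subrr add0r big_distrl /=; apply: eq_bigr => i _.
  by rewrite exprS; field.
have := @cvg_texp v w; rewrite -cvg_shiftS => hS.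
exact: cvgM (cvgB hS (cvg_cst (1 : K))) (cvg_cst w^-1).
Qed.

Lemma cexpN z : cexp (- z) = (cexp z : K)^-1.
Proof.
have h : cexp (- z) * cexp z = (1 : K).
  case: z => a b; rewrite /cexp /= cosN sinN expRN; simpc; rewrite /=.
  have e0 : expR a != 0 by rewrite expR_eq0.
  have cs : cos b * cos b + sin b * sin b = 1 by rewrite -!expr2 cos2Dsin2.
  congr (_ +i* _)%C; last by field.
  transitivity (cos b * cos b + sin b * sin b) => //; field => //.
have z0 : cexp z != 0 by rewrite -cabs_gt0 cabs_cexp expR_gt0.
by rewrite -[LHS](mulfK z0) h mul1r.
Qed.

Lemma inv_cpow (x : R) (z : K) : 1 / cpow x z = cexp (- (toC (ln x) * z)).
Proof. by rewrite cexpN cpowE mul1r mulrC. Qed.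

Lemma near_exp_lt (c t e : R) : 0 <= c -> 0 < t -> 0 < e ->
  \forall m \near \oo, c * expR (- t * m%:R) < e.
Proof.
move=> c0 t0 e0.
have ce : \forall v \near +oo, (c + 1) / e * 2 * expR (- t * v) <= 1 by exact: near_exp_small.
have {}ce : \forall m \near \oo, (c + 1) / e * 2 * expR (- t * m%:R) <= 1.
  exact: (@cvgr_idn R _ ce).
apply: filterS ce => m hm.
have E0 := expR_gt0 (- t * m%:R).
have : (c + 1) * 2 * expR (- t * m%:R) <= e.
  rewrite (_ : _ * _ = e * ((c + 1) / e * 2 * expR (- t * m%:R))); last first.
    by field; exact: lt0r_neq0.
  by rewrite ger_pMr.
by apply: lt_le_trans; rewrite ltr_pM2r //; lra.
Qed.

(** The counting function of [h] is [A exp (alpha u) + O(exp ((alpha - d) u))].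
    Its Dirichlet series is expanded in powers of [w = z - alpha]: by Abel
    summation, the [n]-th coefficient of a partial sum is the opposite of [I n v]
    up to explicit terms, where [I n v] is bounded by a constant times [r^(-n)]
    uniformly in [v] and tends to some [J n]. *)
Context (h : nat -> R) (alpha A C d : R).
Hypotheses (hfin : loc_fin h) (alpha0 : 0 < alpha) (d0 : 0 < d).
Hypothesis HA : forall u, 0 <= u -> `|ncnt alpha h u - A| <= C * expR (- d * u).

(* half of the rate d pays for the powers of v in phi n, the other half is left
   for convergence *)
Let r := d / 2.
Let r0 : 0 < r. Proof. by rewrite divr_gt0. Qed.
Let C0 : 0 <= C.
Proof.
by have := HA (lexx 0); rewrite mulr0 expR0 mulr1; apply: le_trans.
Qed.
Let phi n v := expR (- alpha * v) * (texp n).[v].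
Let Th n : {poly R} := A *: (texp n + alpha *: texp n.+1).
Let I n v := abelI h (phi n) (horner (Th n)) v.

Let step n a b : 0 <= a <= b ->
  `|I n b - I n a| <= C * (alpha + r) / r / r ^+ n * expR (- r * a).
Proof.
move=> /andP[a0 ab].
pose Kn := (texp n)^`() + (- alpha) *: texp n.
have dphi (x : R) := is_derive_exp_poly (- alpha) (texp n) x.
have ThE : (Th n)^`() = A *: Kn.
  by rewrite /Th derivZ derivD (derivZ alpha (texp n.+1)) texp_deriv scalerN /Kn scaleNr.
have dTh (x : R) : is_derive x 1 (horner (Th n)) (A *: Kn).[x].
  by rewrite -ThE; exact: is_derive_poly.
pose c := C * (alpha + r) / r / r ^+ n.
have c0 : 0 <= c by rewrite !divr_ge0 ?mulr_ge0 ?exprn_ge0 ?addr_ge0 // ltW.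
have dLa (x : R) := is_derive_expc (- c) (- r) x.
have KnB (v : R) : 0 <= v -> `|Kn.[v]| <= (alpha + r) / r ^+ n * expR (r * v).
  move=> v0; rewrite /Kn hornerD hornerZ addrC.
  rewrite mulrDl mulrDl; apply: le_trans (ler_normD _ _) _; apply: lerD.
    rewrite normrM normrN (gtr0_norm alpha0) -mulrA; apply: ler_wpM2l; first exact: ltW.
    by have := texp_bound n v r0; rewrite (ger0_norm v0) mulrC.
  by have := texp_deriv_bound n v r0; rewrite (ger0_norm v0).
apply: le_trans (abelI_increment hfin ab dphi dTh dLa _) _.
  move=> v /andP[av vb]; have v0 : 0 <= v by rewrite (le_trans a0) // ltW.
  rewrite (_ : _ - _ = (ncnt alpha h v - A) * Kn.[v]); last first.
    by rewrite /ncnt -/Kn hornerZ; ring.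
  rewrite normrM; apply: le_trans (ler_pM _ _ (HA v0) (KnB v v0)) _ => //.
  rewrite (_ : C * expR (- d * v) * _ = C * ((alpha + r) / r ^+ n) * (expR (- d * v) * expR (r * v))); last by ring.
  rewrite -expRD le_eqVlt; apply/orP; left; apply/eqP.
  congr (_ * expR _); last by rewrite /r; field.
  rewrite /c; field; rewrite expf_neq0; exact: lt0r_neq0.
by rewrite !mulNr opprK gerDr oppr_le0 mulr_ge0 ?expR_ge0.
Qed.

Let Jex n : exists l : R, forall u, 0 <= u ->
  `|I n u - l| <= C * (alpha + r) / r / r ^+ n * expR (- r * u).
Proof. exact: (poly_upto_cauchy r0 (@step n)). Qed.

Let Ibound : exists B : R, forall n v, 0 <= v -> `|I n v| <= B / r ^+ n.
Proof.
pose B0 := psum h (fun t => 1 + expR (- alpha * h t) * expR (r * `|h t|)) 0.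
pose B1 := `|A| * (1 + alpha / r).
exists (C * (alpha + r) / r + (B0 + B1)) => n v v0.
have rn : 0 < r ^+ n by exact: exprn_gt0.
rewrite (_ : I n v = (I n v - I n 0) + I n 0); last by rewrite subrK.
apply: le_trans (ler_normD _ _) _; rewrite mulrDl; apply: lerD.
  have := @step n 0 v; rewrite lexx v0 mulr0 expR0 mulr1 => /(_ isT); exact.
have t0 m : `|(texp m).[0]| <= (r ^+ m)^-1.
  by have := texp_bound m 0 r0; rewrite normr0 mulr0 expR0 mul1r.
rewrite /I /abelI; apply: le_trans (ler_normB _ _) _; rewrite mulrDl; apply: lerD.
  apply: le_trans (ler_norm_psum _ _ _) _.
  rewrite /B0 /psum big_distrl /=; apply: ler_sum => t _.
  apply: le_trans (ler_normB _ _) _; rewrite mulrDl; apply: lerD.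
    by rewrite /phi mulr0 expR0 !mul1r.
  rewrite /phi normrM (ger0_norm (expR_ge0 _)) -mulrA; apply: ler_wpM2l; first exact: expR_ge0.
  exact: texp_bound.
rewrite /Th hornerZ normrM /B1 -mulrA; apply: ler_wpM2l => //.
rewrite hornerD (hornerZ alpha (texp n.+1)).
apply: le_trans (ler_normD _ _) _; rewrite mulrDl mul1r.
apply: lerD; first exact: t0.
rewrite normrM (gtr0_norm alpha0) -mulrA; apply: ler_wpM2l; first exact: ltW.
by rewrite -invfM -exprS.
Qed.

(** The Dirichlet series of [h] is [A alpha / (z - alpha)] minus a power series
    in [z - alpha]; without main term it converges at [alpha] itself. *)
Lemma single_continuation : exists (J : nat -> R) (rho : R) (L : K -> K),
  [/\ 0 < rho, has_ps L (fun n => toC (J n)) (toC alpha) rho,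
     forall z, cabs (z - toC alpha) < rho -> alpha < complex.Re z ->
      series (fun k => cexp (- (toC (h k) * z))) @ \oo -->
        toC (A * alpha) / (z - toC alpha) - L z &
     A = 0 -> series (fun k => expR (- alpha * h k)) @ \oo --> - J 0%N].
Proof.
have [J HJ] := choice Jex.
have [B HB] := Ibound.
have IJ n : I n m%:R @[m --> \oo] --> J n.
  apply/cvgrPdist_lt => e e0.
  have c0 : 0 <= C * (alpha + r) / r / r ^+ n.
    by rewrite !divr_ge0 ?mulr_ge0 ?exprn_ge0 ?addr_ge0 // ltW.
  apply: filterS (near_exp_lt c0 r0 e0) => m; rewrite distrC.
  exact: le_lt_trans (HJ n _ (ler0n _ _)).
pose a n := toC (J n).
pose L z := limn (series (fun n => a n * (z - toC alpha) ^+ n)).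
(* a radius at most 1 keeps the real part of z in the range where the convergence
   of the real Dirichlet series is known *)
pose rho := Num.min r 1.
have rho0 : 0 < rho by rewrite lt_min r0 ltr01.
have rhor : rho <= r by rewrite ge_min lexx.
have rho1 : rho <= 1 by rewrite ge_min lexx orbT.
(* exchange of the sum over n with the limit over m *)
have tann z (P : nat -> K) : cabs (z - toC alpha) < r ->
  (forall m, series (fun n => toC (I n m%:R) * (z - toC alpha) ^+ n) @ \oo --> P m) ->
  series (fun n => a n * (z - toC alpha) ^+ n) @ \oo --> L z /\ P m @[m --> \oo] --> L z.
  move=> zr HP; set w := z - toC alpha in zr HP *.
  have cb : cvgn (series (geometric B (cabs w / r))).
    by apply: geometric_cvg; rewrite divr_ge0 ?cabs_ge0 ?(ltW r0) //= ltr_pdivrMr // mul1r.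
  have pf n : toC (I n m%:R) * w ^+ n @[m --> \oo] --> a n * w ^+ n.
    by apply: cvgM (cvg_cst _); exact: cvg_toC.
  have pP : \forall m \near \oo, (forall n, cabs (toC (I n m%:R) * w ^+ n) <= geometric B (cabs w / r) n) /\
      series (fun n => toC (I n m%:R) * w ^+ n) @ \oo --> P m.
    near=> m; split=> // n; rewrite cabsM cabsX cabs_toC /= expr_div_n mulrA mulrAC.
    by apply: ler_wpM2r (HB n _ (ler0n _ _)); rewrite exprn_ge0 ?cabs_ge0.
  have [L' fL PL] := tannery cb pf pP.
  suff -> : L z = L' by [].
  by apply: cvg_lim fL; exact: norm_hausdorff.
(* closed form of the sum over n for a finite bound m *)
have Iser z m : z != toC alpha -> series (fun n => toC (I n m%:R) * (z - toC alpha) ^+ n) @ \oo -->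
    toC (cnt h m%:R) * cexp (- (toC m%:R * z)) - psum h (fun k => cexp (- (toC (h k) * z))) m%:R
    - toC A * (cexp (- (toC m%:R * (z - toC alpha)))
       + toC alpha * ((cexp (- (toC m%:R * (z - toC alpha))) - 1) / (z - toC alpha))).
  set w := z - toC alpha => za; have w0 : w != 0 by rewrite subr_eq0.
  have phis v : series (fun n => toC (phi n v) * w ^+ n) @ \oo --> cexp (- (toC v * z)).
    rewrite (_ : cexp _ = toC (expR (- alpha * v)) * cexp (- (toC v * w))); last first.
      by rewrite -cexp_shift; congr cexp; rewrite rmorphM rmorphN /w; ring.
    rewrite (_ : series _ = fun N => toC (expR (- alpha * v)) * series (fun n => toC (texp n).[v] * w ^+ n) N).
      exact: cvgM (cvg_cst _) (@cvg_texp v w).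
    by apply/funext => N; rewrite /series /= big_distrr /=; apply: eq_bigr => i _; rewrite /phi rmorphM mulrA.
  rewrite (_ : series _ = fun N => toC (cnt h m%:R) * series (fun n => toC (phi n m%:R) * w ^+ n) N -
    psum h (fun k => series (fun n => toC (phi n (h k)) * w ^+ n) N) m%:R
    - toC A * (series (fun n => toC (texp n).[m%:R] * w ^+ n) N +
       toC alpha * series (fun n => toC (texp n.+1).[m%:R] * w ^+ n) N)); last first.
    apply/funext => N; rewrite /series /psum /= exchange_big /= !big_distrr -big_split big_distrr -!sumrB /=.
    apply: eq_bigr => n _; rewrite /I abelIE /Th hornerZ hornerD (hornerZ alpha (texp n.+1)) -big_distrl /=.
    rewrite -[X in _ - X * _ - _](toC_psum h (fun k => phi n (h k))).
    rewrite !rmorphB !rmorphM rmorphD rmorphM /=; ring.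
  suff c3 : (fun N => psum h (fun k => series (fun n => toC (phi n (h k)) * w ^+ n) N) m%:R) @ \oo -->
      psum h (fun k => cexp (- (toC (h k) * z))) m%:R 
    by exact: cvgB (cvgB (cvgM (cvg_cst (toC (cnt h m%:R))) (phis m%:R)) c3)
      (cvgM (cvg_cst (toC A)) (cvgD (@cvg_texp m%:R w)
        (cvgM (cvg_cst (toC alpha)) (@cvg_texpS m%:R w w0)))).
  exact: (@cvg_big_seq _ (fset_set [set t | h t <= m%:R])
    (fun k N => series (fun n => toC (phi n (h k)) * w ^+ n) N)
    (fun k => cexp (- (toC (h k) * z))) (fun k => phis (h k))).
have Lps : has_ps L a (toC alpha) rho.
  move=> z zr; have [->|za] := eqVneq z (toC alpha).
    rewrite /L; apply/cvg_ex; exists (a 0%N); rewrite subrr; apply: cvg_near_cst; near=> n.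
    have n0 : (0 < n)%N by near: n; exact: nbhs_infty_gt.
    rewrite /series /= -(prednK n0) big_nat_recl // expr0 mulr1 big1 ?addr0 // => i _.
    by rewrite expr0n mulr0.
  by have [] := tann z _ (lt_le_trans zr rhor) (fun m => Iser z m za).
exists J, rho, L; split => //.
- move=> z zr zalpha.
  have za : z != toC alpha by apply: contraTneq zalpha => ->; rewrite ltxx.
  have [_ PL] := tann z _ (lt_le_trans zr rhor) (fun m => Iser z m za).
  set w := z - toC alpha in zr PL *; have w0 : w != 0 by rewrite subr_eq0.
  pose t := complex.Re w.
  have t0 : 0 < t by rewrite /t /w raddfB /= subr_gt0.
  have t1 : 0 < t <= 1.
    rewrite t0 (le_trans (ler_norm _)) // (le_trans (cabs_Re _)) // (le_trans (ltW zr)) //.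
  have hP : poly_upto (ncnt alpha h) A%:P d by exists C => // u u0; rewrite hornerC HA.
  have [D HD] := is_dsum_ex (ltW alpha0) hfin d0 hP t1.
  have zE : complex.Re z = alpha + t by rewrite /t /w raddfB /= addrC subrK.
  have fb k : cabs (cexp (- (toC (h k) * z))) <= expR (- (alpha + t) * h k).
    rewrite cabs_cexp (_ : complex.Re _ = - (alpha + t) * h k) // -zE.
    by case: (z) => x y; rewrite /toC; simpc; rewrite /= mulrC.
  have [S fS pS] := series_psum_cvg hfin HD fb.
  have vanish (x : nat -> K) (c : R) : (forall m, cabs (x m) <= c * expR (- t * m%:R)) ->
      x m @[m --> \oo] --> (0 : K).
    move=> xc; apply/cvgCP => e e0.
    have c0 : 0 <= c by have := xc 0%N; rewrite mulr0 expR0 mulr1; apply: le_trans; exact: cabs_ge0.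
    apply: filterS (near_exp_lt c0 t0 e0) => m; rewrite sub0r cabsN.
    exact: le_lt_trans (xc m).
  have v1 : toC (cnt h m%:R) * cexp (- (toC m%:R * z)) @[m --> \oo] --> (0 : K).
    apply: (vanish _ (`|A| + C)) => m.
    rewrite cabsM cabs_toC cabs_cexp.
    rewrite (_ : complex.Re _ = - alpha * m%:R + - t * m%:R); last first.
      rewrite -mulrDl -opprD -zE; case: (z) => x y; rewrite /toC; simpc.
      by rewrite /= mulrC.
    rewrite expRD mulrA; apply: ler_wpM2r; first exact: expR_ge0.
    rewrite ger0_norm; last by rewrite /cnt; exact: psum_ge0.
    rewrite mulrC -/(ncnt alpha h m%:R).
    rewrite (_ : ncnt _ _ _ = A + (ncnt alpha h m%:R - A)); last by ring.
    apply: lerD; first exact: ler_norm.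
    apply: le_trans (ler_norm _) _; apply: le_trans (HA (ler0n _ m)) _.
    rewrite -[leRHS]mulr1; apply: ler_wpM2l => //.
    by rewrite -expR0 ler_expR mulNr oppr_le0 mulr_ge0 // ltW.
  have v2 : cexp (- (toC m%:R * w)) @[m --> \oo] --> (0 : K).
    apply: (vanish _ 1) => m; rewrite mul1r cabs_cexp.
    rewrite (_ : complex.Re _ = - t * m%:R) // /t; case: (w) => x y.
    by rewrite /toC; simpc; rewrite /= mulrC.
  have := cvgC_unique PL (cvgB (cvgB v1 pS) (cvgM (cvg_cst (toC A))
    (cvgD v2 (cvgM (cvg_cst (toC alpha)) (cvgM (cvgB v2 (cvg_cst (1 : K))) (cvg_cst w^-1)))))).
  rewrite rmorphM /= => LE.
  have SE : S = toC A * toC alpha / w - L z by rewrite LE; ring.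
  rewrite -SE; exact: fS.
move=> A0.
have hE m : I 0%N m = ncnt alpha h m - psum h (fun k => expR (- alpha * h k)) m.
  rewrite /I abelIE /Th A0 scale0r horner0 subr0 /phi /ncnt.
  have t1 v : (texp 0).[v] = 1 by rewrite texpE expr0 divr1.
  rewrite t1 mulr1 mulrC; congr (_ - _).
  by rewrite /psum; apply: eq_bigr => t _; rewrite /= t1 mulr1.
have ps : psum h (fun k => expR (- alpha * h k)) m%:R @[m --> \oo] --> - J 0%N.
  have n0 : ncnt alpha h m%:R @[m --> \oo] --> (0 : R).
    apply/cvgrPdist_lt => e e0.
    apply: filterS (near_exp_lt C0 d0 e0) => m; rewrite distrC -A0.
    exact: le_lt_trans (HA (ler0n _ m)).
  rewrite (_ : (fun m : nat => _) = fun m : nat => ncnt alpha h m%:R - I 0%N m%:R).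
    by rewrite -[- J 0%N]sub0r; exact: cvgB n0 (IJ 0%N).
  by apply/funext => m; rewrite hE opprB addrC subrK.
have psle v : psum h (fun k => expR (- alpha * h k)) v <= - J 0%N.
  apply: (cvgr_to_ge ps); near=> m; apply: psum_exp_mono => //.
  by near: m; exact: nbhs_infty_ger.
have dsumJ : is_dsum h alpha (- J 0%N).
  split => // e e0.
  have /cvgrPdist_lt/(_ e e0)[N _ HN] := ps.
  exists N%:R; have := HN N (leqnn N); rewrite /= => /(le_lt_trans (ler_norm _)); lra.
have fb k : cabs (toC (expR (- alpha * h k))) <= expR (- alpha * h k).
  by rewrite cabs_toC ger0_norm ?expR_ge0.
have [S fS pS] := series_psum_cvg hfin dsumJ fb.
have SE : S = toC (- J 0%N).
  have h1 : psum h (fun k => toC (expR (- alpha * h k))) m%:R @[m --> \oo] --> toC (- J 0%N).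
    rewrite (_ : (fun m : nat => _) = fun m : nat =>
      toC (psum h (fun k => expR (- alpha * h k)) m%:R)); first exact: cvg_toC.
    by apply/funext => m; rewrite toC_psum.
  exact: cvgC_unique pS h1.
move: fS; rewrite SE toC_series => /cvgCP fS.
apply/cvgrPdist_lt => e /fS; apply: filterS => n.
by rewrite -rmorphB cabs_toC.
Unshelve. all: by end_near.
Qed.

End SingleSequence.

(** * From counting functions to their logarithmic form *)

Section LogScale.
Context {R : realType}.

Lemma powRE (x a : R) : 0 < x -> x `^ a = expR (a * ln x).
Proof. by move=> x0; rewrite /powR gt_eqF. Qed.

Lemma counting_fin (T : choiceType) (S : set T) :
  (counting S : \bar R) \is a fin_num -> finite_set S.
Proof. by rewrite /counting; case: asboolP. Qed.

Lemma loc_fin_log (T : choiceType) (f : T -> R) : (forall t, 0 < f t) ->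
  (\forall x \near +oo, counting_fun f x \is a fin_num) -> loc_fin (@ln R \o f).
Proof.
move=> f0 Nfin u; near +oo_R => x.
have ux : expR u <= x by near: x; apply: nbhs_pinfty_ge; exact: num_real.
have /counting_fin : counting_fun f x \is a fin_num by near: x.
apply: sub_finite_set => t /= htu; apply: le_trans ux.
by rewrite -(lnK (f0 t : f t \in Num.pos)) ler_expR.
Unshelve. all: by end_near.
Qed.

Lemma counting_log (T : choiceType) (f : T -> R) (x : R) : (forall t, 0 < f t) ->
  loc_fin (@ln R \o f) -> 0 < x -> counting_fun f x = (cnt (@ln R \o f) (ln x))%:E.
Proof.
move=> f0 fin x0; rewrite /counting_fun cntE.
have -> : [set t | f t <= x] = [set t | (@ln R \o f) t <= ln x].
  by apply/seteqP; split => t /=; rewrite ler_ln // posrE.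
by rewrite /counting asboolT //; exact: fin.
Qed.

(** The asymptotic hypothesis becomes a bound valid for all [u >= 0]: on the
    bounded range left out by the asymptotics, the counting function is bounded
    by monotonicity. *)
Lemma ncnt_bound (T : choiceType) (f : T -> R) (alpha tau A k : R) :
  (forall t, 0 < f t) -> loc_fin (@ln R \o f) -> 0 <= tau < alpha ->
  (\forall x \near +oo, `|fine (counting_fun f x) - A * x `^ alpha| <= k * `|x `^ tau|) ->
  exists C, forall u, 0 <= u ->
    `|ncnt alpha (@ln R \o f) u - A| <= C * expR (- (alpha - tau) * u).
Proof.
move=> f0 fin /andP[tau0 ta] [X [_ HX]].
pose U := ln (Num.max X 1 + 1).
have X1 : 0 < Num.max X 1 + 1 by rewrite ltr_wpDl // le_max ler01 orbT.
pose h := @ln R \o f.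
have U0 : 0 <= U by rewrite ln_ge0 // lerDr le_max ler01 orbT.
exists (`|k| + (cnt h U + `|A|) * expR ((alpha - tau) * U)) => u u0.
rewrite mulrDl; have [Uu|uU] := leP U u.
  rewrite -[leLHS]addr0; apply: lerD; last first.
    by rewrite !mulr_ge0 ?expR_ge0 ?addr_ge0 // /cnt psum_ge0.
  have Xu : X < expR u.
    apply: (@lt_le_trans _ _ (expR U)); last by rewrite ler_expR.
    rewrite lnK // (@le_lt_trans _ _ (Num.max X 1)) ?le_max ?lexx //.
    by rewrite ltrDl.
  have := HX _ Xu; rewrite /= counting_log ?expR_gt0 // expRK /= !powRE ?expR_gt0 // expRK.
  rewrite (ger0_norm (expR_ge0 (tau * u))) => H.
  rewrite (_ : _ - A = expR (- alpha * u) * (cnt h u - A * expR (alpha * u))); last first.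
    rewrite /ncnt mulrBr mulrCA -expRD mulNr addNr expR0 mulr1 //.
  rewrite normrM (ger0_norm (expR_ge0 _)).
  rewrite (_ : - (alpha - tau) * u = - alpha * u + tau * u); last by ring.
  rewrite expRD mulrCA; apply: ler_wpM2l; first exact: expR_ge0.
  apply: le_trans H _; apply: ler_wpM2r; [exact: expR_ge0 | exact: ler_norm].
rewrite -[leLHS]add0r; apply: lerD; first by rewrite mulr_ge0 ?expR_ge0.
rewrite -mulrA -expRD -[leLHS]mulr1.
have c0 v : 0 <= cnt h v by rewrite /cnt psum_ge0.
apply: ler_pM => //.
  apply: le_trans (ler_normB _ _) _; rewrite lerD2r ger0_norm ?mulr_ge0 ?expR_ge0 //.
  rewrite -[leRHS]mul1r; apply: ler_pM; rewrite ?expR_ge0 //.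
    by rewrite -expR0 ler_expR mulNr oppr_le0 mulr_ge0 // (le_trans tau0) // ltW.
  by rewrite /cnt; apply: psum_mono => //; exact: ltW.
rewrite -expR0 ler_expR (_ : _ + _ = (alpha - tau) * (U - u)); last by ring.
by rewrite mulr_ge0 // subr_ge0 ltW.
Qed.

End LogScale.

(** * Identification of the polynomial with the principal part *)

Section Coefficients.
Context {R : realType}.
Local Notation K := (Cfield R).

(** A polynomial which is [O(t^m)] as [t] tends to 0 from the right has no term of
    degree less than [m]. *)
Lemma poly_small_coef (Z : {poly K}) (C t0 : R) m : 0 < t0 ->
  (forall t : R, 0 < t <= t0 -> cabs Z.[toC t] <= C * t ^+ m) ->
  forall i, (i < m)%N -> Z`_i = 0.
Proof.
move=> t00; elim: m Z => // m IH Z HZ.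
have [Z' [z ZE]] : exists Z' z, Z = Z' * 'X + z%:P.
  elim/poly_ind: Z {HZ} => [|p c _]; last by exists p, c.
  by exists 0, 0; rewrite mul0r addr0.
pose S := \sum_(i < size Z') cabs Z'`_i.
have S0 : 0 <= S by apply: sumr_ge0 => i _; exact: cabs_ge0.
have bZ' (t : R) : 0 <= t <= 1 -> cabs Z'.[toC t] <= S.
  move=> /andP[tt0 t1]; rewrite horner_coef; apply: le_trans (cabs_sum _ _ _) _.
  apply: ler_sum => i _; rewrite cabsM cabsX cabs_toC ger0_norm //.
  rewrite -[leRHS]mulr1; apply: ler_wpM2l; [exact: cabs_ge0 | exact: exprn_ile1].
have z0 : z = 0.
  apply/eqP; rewrite -cabs_eq0 eq_le cabs_ge0 andbT.
  apply/ler_addgt0Pr => e e0; rewrite add0r.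
  pose t := Num.min (Num.min t0 1) (e / (`|C| + S + 1)).
  have CS : 0 < `|C| + S + 1 by rewrite ltr_wpDl // addr_ge0.
  have tt0 : 0 < t by rewrite !lt_min t00 ltr01 divr_gt0.
  have tle : t <= t0 by rewrite !ge_min lexx.
  have t1 : t <= 1 by rewrite !ge_min lexx orbT.
  have te : t * (`|C| + S + 1) <= e by rewrite -ler_pdivlMr // !ge_min lexx orbT.
  have := HZ t; rewrite tt0 tle ZE !hornerE => /(_ isT) h1.
  have h2 := bZ' t; rewrite (ltW tt0) t1 in h2; have {}h2 := h2 isT.
  rewrite (_ : z = (Z'.[toC t] * toC t + z) - Z'.[toC t] * toC t); last by ring.
  apply: le_trans (cabsB _ _) _; rewrite cabsM cabs_toC (gtr0_norm tt0).
  apply: le_trans te.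
  apply: (@le_trans _ _ (`|C| * t + S * t)).
    apply: lerD; last by apply: ler_wpM2r => //; exact: ltW.
    apply: le_trans h1 _; rewrite exprS mulrA.
    rewrite -[leRHS]mulr1; apply: (@le_trans _ _ (`|C| * t * t ^+ m)).
      apply: ler_wpM2r; first by rewrite exprn_ge0 // ltW.
      by apply: ler_wpM2r; [exact: ltW | exact: ler_norm].
    apply: ler_wpM2l; first by rewrite mulr_ge0 // ltW.
    by apply: exprn_ile1 => //; exact: ltW.
  by rewrite -mulrDl mulrC; apply: ler_wpM2l; [exact: ltW | rewrite lerDl].
move=> [_|i]; first by rewrite ZE z0 coefD coefMX coefC /= addr0.
rewrite ltnS => im; rewrite ZE coefD coefMX coefC /= addr0.
apply: IH im => t /andP[tt0 tle]; have := HZ t; rewrite tt0 tle => /(_ isT).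
rewrite ZE z0 addr0 hornerM hornerX cabsM cabs_toC (gtr0_norm tt0) exprS mulrCA mulrC.
by rewrite ler_pM2l.
Qed.

(** [Dt t] stands for the value of the Dirichlet series at [alpha + t].  Comparing
    the Taylor expansion of [F] with that of [t^nu (alpha + t) polar P t] modulo
    [t^nu] determines the first [nu] coefficients of [F] and bounds the degree of
    [P].  As the degree of [P] is not known beforehand, everything is first
    multiplied by [t^n], where [n] is the size of [P]. *)
Lemma coef_identification (F : K -> K) (a : nat -> K) (alpha r t1 B : R)
    (P : {poly R}) (nu : nat) (Dt : R -> R) :
  0 < alpha -> 0 < r -> 0 < t1 -> (0 < nu)%N -> has_ps F a (toC alpha) r ->
  (forall t, 0 < t <= t1 -> F (toC (alpha + t)) = toC (t ^+ nu * Dt t)) ->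
  (forall t, 0 < t <= t1 -> `|Dt t - (alpha + t) * polar P t| <= B) ->
  let rho k := P`_k * k`!%:R in
  (forall k, (nu <= k)%N -> rho k = 0) /\
  (forall k, (k < nu)%N -> a k = toC (alpha * rho (nu - 1 - k)%N + rho (nu - k)%N)).
Proof.
move=> alpha0 r0 t10 nu0 Fps HF HD rho.
pose n := size P.
have [C HC] := has_ps_remainder nu r0 Fps.
pose Rp : {poly R} := \sum_(k < n) rho k *: 'X^(nu + n - 1 - k).
have RpE j : (j < nu + n)%N -> Rp`_j = rho (nu + n - 1 - j)%N.
  move=> jn; rewrite /Rp coef_sum.
  have [Hn|Hn] := ltnP (nu + n - 1 - j) n; last first.
    rewrite {2}/rho nth_default // mul0r big1 // => k _.
    rewrite coefZ coefXn (_ : (_ == _) = false) ?mulr0 //.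
    by apply/eqP; have := ltn_ord k; lia.
  rewrite (bigD1 (Ordinal Hn)) //= coefZ coefXn (_ : (_ == _) = true) ?mulr1; last by apply/eqP; lia.
  rewrite big1 ?addr0 // => k /eqP kn; rewrite coefZ coefXn (_ : (_ == _) = false) ?mulr0 //.
  apply/eqP => jk; apply: kn; apply: val_inj => /=; have := ltn_ord k; lia.
pose Z : {poly K} := 'X^n * \poly_(k < nu) a k - map_poly (@toC R) ((alpha%:P + 'X) * Rp).
pose t0 := Num.min (r / 4) (Num.min t1 1).
have t00 : 0 < t0 by rewrite !lt_min divr_gt0 // t10 ltr01.
have Zsmall (t : R) : 0 < t <= t0 -> cabs Z.[toC t] <= (`|C| + `|B|) * t ^+ (nu + n).
  rewrite !le_min => /andP[tt0 /and3P[tr tt1 t1']].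
  have E1 : F (toC (alpha + t)) = toC (t ^+ nu * Dt t) by apply: HF; rewrite tt0.
  have E2 : `|Dt t - (alpha + t) * polar P t| <= B by apply: HD; rewrite tt0.
  have E3 : cabs (F (toC alpha + toC t) - \sum_(k < nu) a k * toC t ^+ k) <= C * t ^+ nu.
    by apply: HC; rewrite tt0.
  have E4 : ((alpha%:P + 'X) * Rp).[t] = t ^+ n * (t ^+ nu * ((alpha + t) * polar P t)).
    rewrite hornerM hornerD hornerC hornerX.
    suff -> : Rp.[t] = t ^+ n * t ^+ nu * polar P t by ring.
    rewrite /Rp horner_sum /polar big_distrr /=.
    apply: eq_bigr => k _; rewrite hornerZ hornerXn -/(rho k).
    have tn : t != 0 by exact: lt0r_neq0.
    have kn := ltn_ord k.
    have -> : (nu + n - 1 - k)%N = (nu + (n - k.+1))%N by lia.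
    have nE : t ^+ n = t ^+ (n - k.+1) * t ^+ k.+1 by rewrite -exprD subnK.
    rewrite nE exprD; field.
    by rewrite expf_neq0.
  have -> : Z.[toC t] = toC t ^+ n * (- (F (toC alpha + toC t) - \sum_(k < nu) a k * toC t ^+ k)
     + toC (t ^+ nu * (Dt t - (alpha + t) * polar P t))).
    rewrite /Z hornerD hornerN hornerM hornerXn horner_poly horner_map E4.
    rewrite -rmorphD E1 mulrBr !rmorphM rmorphB !rmorphM !rmorphXn /=; ring.
  rewrite cabsM cabsX cabs_toC (gtr0_norm tt0) exprD mulrC [leRHS]mulrA.
  apply: ler_wpM2r; first by rewrite exprn_ge0 // ltW.
  apply: le_trans (cabsD _ _) _; rewrite cabsN [leRHS]mulrDl; apply: lerD.
    apply: le_trans E3 _; apply: ler_wpM2r; [by rewrite exprn_ge0 // ltW | exact: ler_norm].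
  rewrite cabs_toC normrM normrX (gtr0_norm tt0) mulrC; apply: ler_wpM2r.
    by rewrite exprn_ge0 // ltW.
  exact: le_trans E2 (ler_norm _).
have Zcoef := poly_small_coef t00 Zsmall.
have coefE j : (j < nu + n)%N -> (if (j < n)%N then 0 else a (j - n)%N) =
    toC (alpha * rho (nu + n - 1 - j)%N + (if j == 0%N then 0 else rho (nu + n - j)%N)).
  move=> jn; have := Zcoef j jn; rewrite /Z coefB coefXnM.
  rewrite (_ : (map_poly _ _)`_j = toC (alpha * rho (nu + n - 1 - j)%N + (if j == 0%N then 0 else rho (nu + n - j)%N))); last first.
    rewrite coef_map mulrDl coefD coefCM RpE // coefXM.
    congr (toC (_ + _)); case: j jn => // j jn /=; rewrite RpE; last by lia.
    by congr rho; lia.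
  move=> /eqP; rewrite subr_eq0 => /eqP <-.
  by case: ltnP => // nj; rewrite coef_poly ifT //; lia.
have low j : (j < n)%N -> rho (nu + n - 1 - j)%N = 0.
  elim: j => [|j IH] jn.
    have := coefE 0%N; rewrite jn eqxx addr0 subn0 => /(_ _)/esym H.
    have /H/eqP : (0 < nu + n)%N by lia.
    by rewrite -(rmorph0 (@toC R)) (inj_eq toC_inj) mulf_eq0 (gt_eqF alpha0) => /eqP.
  have := coefE j.+1; rewrite jn /= => /(_ _)/esym H.
  have /H/eqP : (j.+1 < nu + n)%N by lia.
  rewrite (_ : (nu + n - j.+1 = nu + n - 1 - j)%N); last by lia.
  rewrite IH; last by lia.
  by rewrite addr0 -(rmorph0 (@toC R)) (inj_eq toC_inj) mulf_eq0 (gt_eqF alpha0) => /eqP.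
have high k : (nu <= k)%N -> rho k = 0.
  move=> nk; have [kn|nk'] := ltnP k (nu + n).
    have := low (nu + n - 1 - k)%N; rewrite (_ : (nu + n - 1 - (nu + n - 1 - k) = k)%N); last by lia.
    by apply; lia.
  by rewrite /rho nth_default ?mul0r // -/n; lia.
split => // k knu.
have := coefE (k + n)%N; rewrite addnK ifF; last by lia.
move=> ->; last by lia.
congr toC; rewrite (_ : (nu + n - 1 - (k + n) = nu - 1 - k)%N); last by lia.
rewrite (_ : (nu + n - (k + n) = nu - k)%N); last by lia.
case: eqP => // kn0; rewrite (high (nu - k)%N) //; lia.
Qed.

(** The left-hand side is the coefficient of degree [nu - 1] of the power series of
    [F z * (x^z / z)] at [alpha], that is, a residue.  Modulo [(z - alpha)^nu],
    [F z / z] has the coefficients [rho (nu - 1 - k)], and [x^z] those of the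
    exponential; their product gives [x^alpha P(ln x)]. *)
Lemma residue_sum (alpha x : R) (P : {poly R}) (nu : nat) (F : K -> K) (a : nat -> K) (r : R) :
  0 < alpha -> 0 < x -> 0 < r -> has_ps F a (toC alpha) r ->
  let rho k := P`_k * k`!%:R in
  (forall k, (nu <= k)%N -> rho k = 0) ->
  (forall k, (k < nu)%N -> a k = toC (alpha * rho (nu - 1 - k)%N + rho (nu - k)%N)) ->
  \sum_(1 <= q < nu.+1) polar_coef alpha nu F q / (q.-1)`!%:R *
      derive1n q.-1 (fun z : K => cpow x z / z) (toC alpha) =
  toC (x `^ alpha * P.[ln x]).
Proof.
move=> alpha0 x0 r0 Fps rho high low.
have fK k : (k`!%:R : K) != 0.
  by rewrite -(rmorph_nat (@toC R)) fmorph_eq0 pnatr_eq0 -lt0n fact_gt0.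
set u := ln x; pose E := expR (alpha * u).
(* the Taylor coefficients of x^z / z at alpha, divided by x^alpha *)
pose eta q := \sum_(i < q.+1) (u ^+ i / i`!%:R) * ((-1) ^+ (q - i) / alpha ^+ (q - i).+1).
have Hps := has_psM (has_ps_cpow (x := x) (alpha := alpha) (r := alpha)) (has_ps_inv alpha0).
have etaE q : derive1n q (fun z : K => cpow x z / z) (toC alpha) = q`!%:R * toC (E * eta q).
  rewrite (deriven_coef q alpha0 Hps); congr (_ * _).
  rewrite /eta big_distrr rmorph_sum /=; apply: eq_bigr => i _.
  by rewrite -rmorphM -mulrA.
have eta0 : alpha * eta 0%N = 1.
  by rewrite /eta big_ord1 subnn !expr0 expr1 fact0 divr1 !mul1r mulfV // lt0r_neq0.
have etaS q : alpha * eta q.+1 + eta q = u ^+ q.+1 / q.+1`!%:R.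
  rewrite {1}/eta big_ord_recr /= subnn expr0 expr1 mulrDr mulrCA mul1r mulfV ?lt0r_neq0 // mulr1.
  rewrite addrAC -[RHS]add0r; congr (_ + _).
  rewrite /eta big_distrr -big_split /= big1 // => i _.
  have iq : (i <= q)%N by rewrite -ltnS.
  rewrite subSn // !exprS; field.
  by rewrite expf_neq0 lt0r_neq0 //= pnatr_eq0 -lt0n fact_gt0.
have polE q : (1 <= q <= nu)%N -> polar_coef alpha nu F q = a (nu - q)%N.
  by move=> _; rewrite /polar_coef (deriven_coef _ r0 Fps) mul1r mulKf.
rewrite big_add1 /= big_mkord.
transitivity (\sum_(q < nu) toC (E * ((alpha * rho q + rho q.+1) * eta q))).
  apply: eq_bigr => q _; rewrite polE; last by rewrite /= ltn_ord.
  rewrite etaE low; last by have := ltn_ord q; lia.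
  rewrite (_ : (nu - 1 - (nu - q.+1) = q)%N); last by have := ltn_ord q; lia.
  rewrite (_ : (nu - (nu - q.+1) = q.+1)%N); last by have := ltn_ord q; lia.
  rewrite mulrA divfK // -rmorphM; congr toC; ring.
rewrite -rmorph_sum -big_distrr /= powRE //; congr (toC (_ * _)).
have PE : P.[u] = \sum_(q < nu) rho q * (u ^+ q / q`!%:R).
  have sP : (size P <= nu)%N.
    apply/leq_sizeP => j /high /eqP; rewrite mulf_eq0 => /orP[/eqP //|].
    by rewrite pnatr_eq0 -[_ == _]negbK -lt0n fact_gt0.
  rewrite (horner_coef_wide _ sP); apply: eq_bigr => q _; rewrite /rho; field.
  by rewrite pnatr_eq0 -lt0n fact_gt0.
rewrite PE; case: nu high {low polE PE} => [|m] high; first by rewrite !big_ord0.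
transitivity (\sum_(q < m.+1) (alpha * rho q * eta q) + \sum_(q < m.+1) rho q.+1 * eta q).
  by rewrite -big_split; apply: eq_bigr => q _ /=; ring.
rewrite big_ord_recl [X in _ + X]big_ord_recr /= (high m.+1) // mul0r addr0.
rewrite [RHS]big_ord_recl expr0 fact0 divr1 mulr1 -addrA; congr (_ + _).
  by rewrite mulrAC eta0 mul1r.
rewrite -big_split; apply: eq_bigr => q _ /=.
by rewrite -etaS /bump /= add1n; ring.
Qed.

End Coefficients.

(** * The asymptotic formula for the counting function of the products *)

Section Assembly.
Context {R : realType}.
Local Notation K := (Cfield R).

Lemma is_dsum_cvg (T : choiceType) (h : T -> R) (s D : R) : loc_fin h -> is_dsum h s D ->
  psum h (fun t => expR (- s * h t)) m%:R @[m --> \oo] --> D.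
Proof.
move=> hfin [D1 D2]; apply/cvgrPdist_lt => e e0.
have [v Dv] := D2 e e0; near=> m.
have vm : v <= m%:R by near: m; exact: nbhs_infty_ger.
have h1 := psum_exp_mono s hfin vm.
rewrite ger0_norm ?subr_ge0 //; lra.
Unshelve. all: by end_near.
Qed.

Lemma inv_powR (x alpha : R) : 0 < x -> 1 / x `^ alpha = expR (- alpha * ln x).
Proof. by move=> x0; rewrite powRE // mul1r mulNr expRN. Qed.

Lemma dirichlet_sum_real (lam : nat -> R) (s D : R) :
  loc_fin (@ln R \o lam) -> is_dsum (@ln R \o lam) s D ->
  dirichlet_sum lam (toC s) = toC D.
Proof.
move=> fin HD.
pose f k : K := toC (expR (- s * ln (lam k))).
have fb k : cabs (f k) <= expR (- s * (@ln R \o lam) k).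
  by rewrite /f cabs_toC ger0_norm ?expR_ge0.
have [L fL pL] := series_psum_cvg fin HD fb.
have LD : L = toC D.
  apply: (cvgC_unique pL).
  rewrite (_ : (fun m : nat => _) = fun m : nat =>
     toC (psum (@ln R \o lam) (fun k => expR (- s * (@ln R \o lam) k)) m%:R)).
    by apply: cvg_toC; exact: is_dsum_cvg.
  by apply/funext => m; rewrite toC_psum.
rewrite /dirichlet_sum (_ : (fun k => 1 / cpow (lam k) (toC s)) = f).
  by rewrite -LD; apply: cvg_lim fL; exact: norm_hausdorff.
apply/funext => k; rewrite inv_cpow /f -rmorphM -rmorphN /= /cexp /toC /=.
by rewrite cos0 sin0 mulr1 mulr0 mulrC mulNr.
Qed.

(** The factor of [(z - alpha)^nu] times the product of the Dirichlet series that
    belongs to one sequence; [main] tells whether the sequence has a main term,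
    in which case it receives one of the factors [z - alpha]. *)
Lemma factor_continuation (lam : nat -> R) (alpha A C d : R) (main : bool) :
  (forall k, 0 < lam k) -> loc_fin (@ln R \o lam) -> 0 < alpha -> 0 < d ->
  (forall u, 0 <= u -> `|ncnt alpha (@ln R \o lam) u - A| <= C * expR (- d * u)) ->
  (~~ main -> A = 0) ->
  exists F : K -> K,
  [/\ exists a r, 0 < r /\ has_ps F a (toC alpha) r,
     \forall z \near toC alpha, alpha < complex.Re z ->
       F z = (if main then z - toC alpha else 1) * dirichlet_sum lam z &
     F (toC alpha) = toC (if main then alpha * A
       else limn (series (fun k => 1 / (lam k) `^ alpha)))].
Proof.
move=> lam0 fin alpha0 d0 HA A0.
have [J [r [L [r0 Lps LD LA]]]] := single_continuation fin alpha0 d0 HA.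
have DE z : cabs (z - toC alpha) < r -> alpha < complex.Re z ->
    dirichlet_sum lam z = toC (A * alpha) / (z - toC alpha) - L z.
  move=> zr za; rewrite /dirichlet_sum.
  rewrite (_ : (fun k => _) = fun k => cexp (- (toC ((@ln R \o lam) k) * z))).
    by apply: cvg_lim (LD z zr za); exact: norm_hausdorff.
  by apply/funext => k; rewrite inv_cpow.
case: main A0 => [_|/(_ isT) A0].
  exists (fun z => toC (A * alpha) + -1 * ((z - toC alpha) * L z)).
  have idps : has_ps (fun z => z - toC alpha) (fun n => if n == 1%N then 1 else 0) (toC alpha) r.
    have fin2 n : (2 <= n)%N -> (if n == 1%N then 1 else 0 : K) = 0 by case: n => [|[]].
    apply: has_ps_ext (has_ps_fin fin2) => z _.
    by rewrite !big_ord_recl big_ord0 /= expr0 expr1; ring.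
  have cps : has_ps (fun=> toC (A * alpha)) (fun n => if n == 0%N then toC (A * alpha) else 0) (toC alpha) r.
    have fin1 n : (1 <= n)%N -> (if n == 0%N then toC (A * alpha) else 0 : K) = 0 by case: n.
    apply: has_ps_ext (has_ps_fin fin1) => z _.
    by rewrite big_ord1 expr0 mulr1.
  split.
  - eexists; exists r; split; first exact: r0.
    by apply: has_ps_ext (has_psD cps (has_psZ (k := -1) (has_psM idps Lps))) => z _.
  - apply/nearCP; exists r => // z zr za; rewrite DE //.
    have w0 : z - toC alpha != 0.
      rewrite subr_eq0; apply: contraTneq za => ->; rewrite ltxx //.
    by rewrite mulrBr [_ * (_ / _)]mulrC divfK // mulN1r.
  - by rewrite subrr mul0r mulr0 addr0 mulrC.
exists (fun z => -1 * L z); split.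
- by eexists; exists r; split; [exact: r0 | exact: has_psZ Lps].
- apply/nearCP; exists r => // z zr za; rewrite DE //.
  by rewrite A0 mul0r rmorph0 mul0r sub0r mul1r mulN1r.
rewrite (has_ps_at r0 Lps) mulN1r -rmorphN; congr toC; apply/esym.
rewrite (_ : (fun k => _) = fun k => expR (- alpha * (@ln R \o lam) k)).
  by apply: cvg_lim (LA A0); exact: Rhausdorff.
by apply/funext => k; rewrite inv_powR.
Qed.

End Assembly.

Unset Implicit Arguments.

Theorem proposition2p5 (R : realType) (p nu : nat)
    (lam : 'I_p -> R ^nat) (j_ : 'I_nu -> 'I_p) (A_ : 'I_p -> R) (tau alpha : R)
    (lam_gt0 : forall j k, 0 < lam j k)
    (lam_nd : forall j, nondecreasing_seq (lam j))
    (nu_bounds : (1 <= nu <= p)%N)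
    (j_inj : injective j_)
    (tau_alpha : 0 <= tau < alpha)
    (N_fin : forall j, \forall x \near +oo,
      counting_fun (lam j) x \is a fin_num)
    (A_neq0 : forall q, A_ (j_ q) != 0)
    (N_main : forall q,
      (fun x : R => fine (counting_fun (lam (j_ q)) x)) =
      (fun x : R => A_ (j_ q) * x `^ alpha)
      +O_ +oo (fun x : R => x `^ tau))
    (N_small : forall j, j \notin codom j_ ->
      (fun x : R => fine (counting_fun (lam j) x)) =O_ +oo
      (fun x : R => x `^ tau)) :
  let N := counting_fun (prod_fun lam) in
  let A := (\prod_(q < nu) A_ (j_ q)) *
    (\prod_(j < p | j \notin codom j_)
       limn (series (fun k => 1 / (lam j k) `^ alpha))) in
  let G := fun z : Cfield R =>
    (z - toC alpha) ^+ nu * \prod_(j < p) dirichlet_sum (lam j) z in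
  exists (eta : R) (C : nat -> R),
    [/\ eta < alpha,
        \forall x \near +oo, N x \is a fin_num,
        exists F, continuation_at alpha G F,
        forall F, continuation_at alpha G F ->
          (fun x : R => toC (fine (N x))) =
          (fun x : R => \sum_(1 <= q < nu.+1)
             polar_coef alpha nu F q / (q.-1)`!%:R *
             derive1n q.-1 (fun z : Cfield R => cpow x z / z) (toC alpha))
          +O_ +oo (fun x : R => toC (x `^ eta)) &
        (fun x : R => fine (N x)) =
        (fun x : R => x `^ alpha *
           (A * ((alpha * ln x) ^+ nu.-1 / (nu.-1)`!%:R) +
            \sum_(0 <= q < nu.-1) C q * ln x ^+ q))
        +O_ +oo (fun x : R => x `^ eta)].
Proof.
move=> N A G.
have nu0 : (0 < nu)%N by case/andP: nu_bounds.
have alpha0 : 0 < alpha by case/andP: tau_alpha => /le_lt_trans; apply.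
have d10 : 0 < alpha - tau by rewrite subr_gt0; case/andP: tau_alpha.
pose l j := @ln R \o lam j.
have lfin j : loc_fin (l j) := loc_fin_log (lam_gt0 j) (N_fin j).
pose Aj j := if j \in codom j_ then A_ j else 0.
have bnd j : exists C, forall u, 0 <= u ->
    `|ncnt alpha (l j) u - Aj j| <= C * expR (- (alpha - tau) * u).
  rewrite /Aj; case: (boolP (j \in codom j_)) => [/codomP[q ->]|jn].
    have /eqaddOP/bigO_exP[k k0 Hk] := N_main q.
    exact: ncnt_bound (lam_gt0 _) (lfin _) tau_alpha Hk.
  have /eqOP/bigO_exP[k k0 Hk] := N_small j jn.
  apply: (ncnt_bound (k := k) (lam_gt0 _) (lfin _) tau_alpha).
  by apply: filterS Hk => x; rewrite mul0r subr0.
have lm j : almost_poly (ncnt alpha (l j)).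
  have [C HC] := bnd j; exists (Aj j)%:P, (alpha - tau); split => //; exists C.
    by have := HC 0 (lexx _); rewrite mulr0 expR0 mulr1; apply: le_trans.
  by move=> u u0; rewrite hornerC HC.
have [hfin [P [d [d0 hP]]] hd] := hsum_almost_poly alpha0 lfin lm.
have [C C0 HP] := hP.
have hE : @ln R \o prod_fun lam = hsum l.
  apply/funext => k; rewrite /prod_fun /hsum /= -[RHS]expRK expR_sum.
  by congr ln; apply: eq_bigr => j _; rewrite lnK // posrE.
have prod0 k : 0 < prod_fun lam k by apply: prodr_gt0.
have NE x : 0 < x -> N x = (cnt (hsum l) (ln x))%:E.
  by move=> x0; rewrite /N counting_log // hE.
have est x : 1 <= x -> `|fine (N x) - x `^ alpha * P.[ln x]| <= C * x `^ (alpha - d).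
  move=> x1; have x0 : 0 < x by exact: lt_le_trans x1.
  rewrite NE // !powRE //=; have u0 := ln_ge0 x1.
  rewrite (_ : _ - _ = expR (alpha * ln x) * (ncnt alpha (hsum l) (ln x) - P.[ln x])); last first.
    by rewrite mulrBr /ncnt mulrA -expRD mulNr addrN expR0 mul1r.
  rewrite normrM (ger0_norm (expR_ge0 _)) mulrBl expRD mulrCA.
  by apply: ler_wpM2l; [exact: expR_ge0 | rewrite -mulNr; exact: HP].
have Fex j : exists F : Cfield R -> Cfield R,
  [/\ exists a r, 0 < r /\ has_ps F a (toC alpha) r,
     \forall z \near toC alpha, alpha < complex.Re z ->
       F z = (if j \in codom j_ then z - toC alpha else 1) * dirichlet_sum (lam j) z &
     F (toC alpha) = toC (if j \in codom j_ then alpha * Aj j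
       else limn (series (fun k => 1 / (lam j k) `^ alpha)))].
  have [Cj HCj] := bnd j.
  apply: factor_continuation (lam_gt0 j) (lfin j) alpha0 d10 HCj _.
  by rewrite /Aj => /negbTE ->.
have [Fj HFj] := choice Fex.
pose F0 z := \prod_(j < p) Fj j z.
have F0ps : exists a r, 0 < r /\ has_ps F0 a (toC alpha) r.
  by apply: has_ps_prod => j; have [] := HFj j.
have F0cont : continuation_at alpha G F0.
  split.
    have [a [r [r0 Fps]]] := F0ps; exists a; apply/nearCP; exists r => // z zr; exact: Fps.
  pose good j z := alpha < complex.Re z ->
      Fj j z = (if j \in codom j_ then z - toC alpha else 1) * dirichlet_sum (lam j) z.
  have all : \forall z \near toC alpha, forall j, good j z.
    have near1 j : \forall z \near toC alpha, good j z by case: (HFj j).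
    exact: (@filter_forall _ _ good (nbhs (toC alpha)) _ near1).
  apply: filterS all => z Hz za; rewrite /F0 /G.
  under eq_bigr do rewrite Hz //.
  rewrite big_split /= -big_mkcond /= prodr_const; congr (_ ^+ _ * _).
  by rewrite (card_codom j_inj) card_ord.
have F0alpha : F0 (toC alpha) = toC (alpha ^+ nu * A).
  rewrite /F0 (eq_bigr (fun j => toC (if j \in codom j_ then alpha * Aj j
    else limn (series (fun k => 1 / (lam j k) `^ alpha))))); last by move=> j _; case: (HFj j).
  rewrite -rmorph_prod /=; congr toC.
  rewrite (bigID (fun j => j \in codom j_)) /= /A mulrA; congr (_ * _); last first.
    by apply: eq_bigr => j /negbTE ->.
  rewrite (eq_bigr (fun j => alpha * A_ j)); last by move=> j jc; rewrite /Aj jc.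
  rewrite -big_uniq; last exact/injectiveP.
  by rewrite big_image /= big_split /= prodr_const card_ord.
have dex (jt : 'I_p * R) : exists D, 0 < jt.2 <= 1 -> is_dsum (l jt.1) (alpha + jt.2) D.
  have [t01|] := boolP (0 < jt.2 <= 1); last by exists 0.
  have [P' [d' [d'0 hP']]] := lm jt.1.
  by have [D HD] := is_dsum_ex (ltW alpha0) (lfin jt.1) d'0 hP' t01; exists D.
have [dj Hdj] := choice dex.
(* the real Dirichlet series of the products, at alpha + t *)
pose Dt t := \prod_(j < p) dj (j, t).
have [B HB] := is_dsum_polar (ltW alpha0) hfin d0 hP.
pose rho k := P`_k * k`!%:R.
have ident F : continuation_at alpha G F -> exists a r,
    [/\ 0 < r, has_ps F a (toC alpha) r, forall k, (nu <= k)%N -> rho k = 0 &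
      forall k, (k < nu)%N -> a k = toC (alpha * rho (nu - 1 - k)%N + rho (nu - k)%N)].
  move=> [[a /nearCP[r r0 Fps]] /nearCP[r2 r20 FG]].
  pose t1 := Num.min (r2 / 2) 1.
  have t10 : 0 < t1 by rewrite lt_min divr_gt0 // ltr01.
  have small t : 0 < t <= t1 -> 0 < t <= 1 /\ t < r2.
    by rewrite /t1 le_min => /and3P[t0 tr ->]; rewrite t0; split => //; lra.
  have HD t : 0 < t <= t1 -> `|Dt t - (alpha + t) * polar P t| <= B.
    move=> /small[t01 _]; apply: HB => //; apply: hd => j; exact: (Hdj (j, t)).
  have HF t : 0 < t <= t1 -> F (toC (alpha + t)) = toC (t ^+ nu * Dt t).
    move=> /small[t01 tr2]; have t0 : 0 < t by case/andP: t01.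
    have wE : toC (alpha + t) - toC alpha = toC t by rewrite rmorphD /= addrAC subrr add0r.
    rewrite FG; first last.
    - by rewrite /= ltrDl.
    - by rewrite wE cabs_toC gtr0_norm.
    rewrite /G wE rmorphM rmorphXn rmorph_prod /=; congr (_ * _); apply: eq_bigr => j _.
    exact: dirichlet_sum_real (lfin j) (Hdj (j, t) t01).
  have [h1 h2] := coef_identification alpha0 r0 t10 nu0 Fps HF HD.
  by exists a, r.
exists (alpha - d), (fun q => P`_q); split.
- by rewrite ltrBlDr ltrDl.
- near=> x; have x0 : 0 < x by near: x; apply: nbhs_pinfty_gt; exact: num_real.
  by rewrite NE.
- by exists F0.
- move=> F /ident[a [r [r0 Fps high low]]].
  apply/eqaddOP/bigO_exP; exists (toC (C + 1)).
    by rewrite -(rmorph0 (@toC R)) toC_lt ltr_wpDl.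
  near=> x; have x1 : 1 <= x by near: x; apply: nbhs_pinfty_ge; exact: num_real.
  have x0 : 0 < x by exact: lt_le_trans x1.
  rewrite !fctE (residue_sum alpha0 x0 r0 Fps high low).
  rewrite -[toC _ - _]rmorphB -!toC_cabs -rmorphM toC_le !cabs_toC.
  rewrite [X in _ <= _ * X]ger0_norm ?powR_ge0 //; apply: le_trans (est x x1) _.
  by apply: ler_wpM2r; rewrite ?powR_ge0 // lerDl.
have [a [r [r0 F0ps' high low]]] := ident _ F0cont.
(* the value at alpha of the continuation determines the leading coefficient *)
have lead : rho nu.-1 = alpha ^+ nu.-1 * A.
  have := has_ps_at r0 F0ps'; rewrite F0alpha (low _ nu0) !subn0 (high nu) // addr0 => /toC_inj.
  rewrite -[in LHS](prednK nu0) exprS -mulrA subn1 => /(mulfI (lt0r_neq0 alpha0)) ->.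
  by [].
have sP : (size P <= nu)%N.
  apply/leq_sizeP => j /high /eqP; rewrite mulf_eq0 => /orP[/eqP //|].
  by rewrite pnatr_eq0 -[_ == _]negbK -lt0n fact_gt0.
have PE u : P.[u] = A * ((alpha * u) ^+ nu.-1 / (nu.-1)`!%:R) +
    \sum_(0 <= q < nu.-1) P`_q * u ^+ q.
  rewrite (horner_coef_wide _ sP) -(prednK nu0) big_ord_recr /= addrC big_mkord.
  congr (_ + _).
  have -> : P`_nu.-1 = rho nu.-1 / (nu.-1)`!%:R.
    by rewrite /rho mulfK // pnatr_eq0 -lt0n fact_gt0.
  by rewrite lead exprMn; ring.
apply/eqaddOP/bigO_exP; exists (C + 1); first by rewrite ltr_wpDl.
near=> x; have x1 : 1 <= x by near: x; apply: nbhs_pinfty_ge; exact: num_real.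
rewrite !fctE -PE [X in _ <= _ * X]ger0_norm ?powR_ge0 //; apply: le_trans (est x x1) _.
by apply: ler_wpM2r; rewrite ?powR_ge0 // lerDl.
Unshelve. all: by end_near.
Qed.
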